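(* Let $\alpha\in[0,1]$, let $\mathcal H=\{(w_i,s_i,q_i)\}_{i=1}^T$ be a history, let $\boldsymbol\eta=(\eta_1,\dots,\eta_T)\ge0$ and $\eta_0\ge0$ be price-error radii, and let $w_0$ be a new wholesale price. Let $$q_{\min,\alpha}^{\mathrm{PE},\boldsymbol\eta,\eta_0}(w_0)=\inf\{\bar F(y):F\in\mathcal F_\alpha^{\mathrm{PE},\boldsymbol\eta}(\mathcal H),\ y\in\mathcal A_F(w_0;\eta_0)\}.$$ If $\mathcal F_\alpha^Q(\mathcal H)\neq\varnothing$, then $$q_{\min,\alpha}^{\mathrm{PE},\boldsymbol\eta,\eta_0}(w_0)=\min_{\omega\in\Omega(\boldsymbol\eta,\eta_0)}\ \inf_{p\in\mathcal P_\omega}q_0^e,$$ where $q_0^e$ is demand at the realized current price. An attained worst case is piecewise $\bar G_\alpha$; otherwise such curves approach the same infimum.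
   Context: Setting. Consumer valuations have distribution $F$ with density $f$ and tail demand $\bar F=1-F$. The retailer's optimal prices at wholesale price $w$ are $\mathcal S_F(w)=\arg\max_{s\ge w}(s-w)\bar F(s)$, assumed nonempty and compact (boundary responses $s=w$ are interpreted as limits). $F$ is $\alpha$-regular if $s\mapsto(1-\alpha)s-\bar F(s)/f(s)$ is nondecreasing. A history satisfies $s_1<\cdots<s_T$, $1>q_1>\cdots>q_T>0$, $s_i>w_i$. $\mathcal F_\alpha^Q(\mathcal H)=\{F:\ F\text{ is }\alpha\text{-regular},\ \bar F(s_i)=q_i\ \forall i\}$. With $\mathrm{dist}(s,S)=\inf_{r\in S}|s-r|$, $\mathcal F_\alpha^{\mathrm{PE},\boldsymbol\eta}(\mathcal H)=\{F\in\mathcal F_\alpha^Q(\mathcal H):\mathrm{dist}(s_i,\mathcal S_F(w_i))\le\eta_i\ \forall i\}$ and $\mathcal A_F(w_0;\eta_0)=\{y\ge w_0:\mathrm{dist}(y,\mathcal S_F(w_0))\le\eta_0\}$. Coordinates and closure convention. $x_\alpha(q)=(q^{-(1-\alpha)}-1)/(1-\alpha)$ for $\alpha<1$, $x_1(q)=-\log q$; $Q_\alpha$ is the inverse of $x_\alpha$; $v(x)=\bar F^{-1}(Q_\alpha(x))$. $\alpha$-regularity corresponds to $v$ increasing and concave; curves whose $v$ is increasing and concave with kinks are admitted as limits of positive-density ones. Configurations. Let $x_i=x_\alpha(q_i)$. A configuration is $p=(\{(\tilde x_i,\tilde s_i,\tilde m_i)\}_{i=1}^T,\,x_0^\star,r_0,m_0,\,x_0^e,y_0)$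 with all transformed coordinates $\tilde x_i,x_0^\star,x_0^e\ge0$, all slopes $\tilde m_i,m_0>0$, and $\tilde s_i=w_i+[1+(1-\alpha)\tilde x_i]\tilde m_i$, $|\tilde s_i-s_i|\le\eta_i$ for $i=1,\dots,T$; $r_0=w_0+[1+(1-\alpha)x_0^\star]m_0$, $|y_0-r_0|\le\eta_0$, $y_0\ge w_0$. (Here $\tilde s_i$ is a latent exact optimum for the historical wholesale price $w_i$, $r_0$ the exact optimum for $w_0$, and $y_0$ the realized current price, at which demand is $q_0^e=Q_\alpha(x_0^e)$.) Form the point nodes $\{(x_i,s_i)\}_{i=1}^T\cup\{(\tilde x_i,\tilde s_i)\}_{i=1}^T\cup\{(x_0^\star,r_0),(x_0^e,y_0)\}$; nodes with equal first coordinate must have equal second coordinate and are merged. Order the merged nodes as $(\xi_j,\nu_j)$, $0\le\xi_1<\cdots<\xi_M$, with secants $C_j=(\nu_{j+1}-\nu_j)/(\xi_{j+1}-\xi_j)$, $j=1,\dots,M-1$, $C_0=+\infty$, $C_M=0$. The configuration is feasible if $C_1\ge C_2\ge\cdots\ge C_{M-1}>0$ and, for each required slope $\mu$ at node $j$ (slope $\tilde m_i$ at the node $\tilde x_i$, slope $m_0$ at the node $x_0^\star$), $C_{j-1}\ge\mu\ge C_j$. Orderings. $\Omega(\boldsymbol\eta,\eta_0)$ is the finite collection of relative orderings of the observed prices, their latent exact optima, and the current exact and realized prices (that is, of the nodes above, coincidences allowed); $\mathcal P_\omega$ is the finite program consisting of the feasible configurations with ordering $\omega$. Generalized-Pareto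 curves. $\bar\Gamma_\alpha(t)=[1+(1-\alpha)t]^{-1/(1-\alpha)}$ for $0\le\alpha<1$ and $\bar\Gamma_1(t)=e^{-t}$, on the natural domain. For $a<b$ and $q_a>q_b$, with $\ell=a+(b-a)\,\bar\Gamma_\alpha^{-1}(1/q_a)/\bar\Gamma_\alpha^{-1}(q_b/q_a)$, set $\bar G_\alpha(v\mid a,q_a,b,q_b)=1$ for $v<\ell$ and $\bar G_\alpha(v\mid a,q_a,b,q_b)=q_a\bar\Gamma_\alpha\big(\bar\Gamma_\alpha^{-1}(q_b/q_a)\tfrac{v-a}{b-a}\big)$ for $v\ge\ell$. A tail demand curve is piecewise $\bar G_\alpha$ if it is put together from pieces of curves of this form. A worst case is a demand curve in $\mathcal F_\alpha^{\mathrm{PE},\boldsymbol\eta}(\mathcal H)$ with a realized price in $\mathcal A_F(w_0;\eta_0)$ whose demand equals the infimum.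
   Formalization: ''An attained worst case is piecewise'' is read as: if the infimum is attained, some worst case is piecewise (not every one is); if the infimum is 0, pieces are finite in number only above each positive demand level, since every generalized-Pareto curve is positive. *)

(* Defs.v *)
From HB Require Import structures.
From mathcomp Require Import all_boot all_order all_algebra.
From mathcomp Require Import all_classical all_reals all_analysis.

Set Implicit Arguments.
Unset Strict Implicit.
Unset Printing Implicit Defensive.
Import Order.TTheory GRing.Theory Num.Theory.
Import numFieldNormedType.Exports.

Local Open Scope classical_set_scope.
Local Open Scope ring_scope.

(** * Coordinates *)

Definition xcoord (R : realType) (al q : R) : R :=
  if al == 1 then - ln q else (q `^ (- (1 - al)) - 1) / (1 - al).

(* Both the standard generalized-Pareto tail and, on [0 <= t], the inverse
   Q_al of [xcoord al]; see [GammabarK] and [xcoordK]. [xcoord al] is used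
   on all of ]0, +oo[ as the inverse of this tail on its natural domain. *)
Definition Gammabar (R : realType) (al t : R) : R :=
  if al == 1 then expR (- t) else (1 + (1 - al) * t) `^ (- (1 - al)^-1).

Lemma GammabarK (R : realType) (al q : R) :
  0 < q -> Gammabar al (xcoord al q) = q.
Proof.
move=> q0; rewrite /Gammabar /xcoord; case: eqVneq => [_|al1].
  by rewrite opprK lnK.
have h : 1 - al != 0 by rewrite subr_eq0 eq_sym.
rewrite mulrC divfK // addrC subrK -powRrM mulrNN divff //.
by rewrite powRr1 // ltW.
Qed.

Lemma xcoordK (R : realType) (al t : R) :
  0 < 1 + (1 - al) * t -> xcoord al (Gammabar al t) = t.
Proof.
move=> t0; rewrite /Gammabar /xcoord; case: eqVneq => [_|al1].
  by rewrite expRK opprK.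
have h : 1 - al != 0 by rewrite subr_eq0 eq_sym.
rewrite -powRrM mulrNN mulVf // powRr1 ?ltW //.
by rewrite addrC addKr mulrAC divff // mul1r.
Qed.

(** * Demand curves and retailer responses *)

(* A valuation distribution is represented by its cdf [F : R -> R];
   valuations may be negative. *)

Definition tail (R : realType) (F : R -> R) (s : R) : R := 1 - F s.

Definition has_density (R : realType) (F f : R -> R) : Prop :=
  [/\ measurable_fun [set: R] f,
      (forall x, 0 <= f x),
      (\int[lebesgue_measure]_x (f x)%:E = 1)%E &
      forall s, ((F s)%:E = \int[lebesgue_measure]_(x in `]-oo, s]) (f x)%:E)%E].

(* [f] ranges over all versions of the density and need not be continuous.
   With q = tail F s, x = xcoord al q and v the price as a function of x, one
   has tail F s / f s = (1 + (1 - al) * x) * v'(x): a concave kink of v is a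
   downward jump of this ratio, so increasing concave curves v with kinks are
   al-regular for a one-sided version of the density. *)
Definition alpha_regular (R : realType) (al : R) (F : R -> R) : Prop :=
  exists f : R -> R,
    [/\ has_density F f,
        (forall s, 0 < tail F s < 1 -> 0 < f s) &
        forall s t, 0 < tail F s < 1 -> 0 < tail F t < 1 -> s <= t ->
          (1 - al) * s - tail F s / f s <= (1 - al) * t - tail F t / f t].

Definition responses (R : realType) (F : R -> R) (w : R) : set R :=
  [set s | w <= s /\
           forall t, w <= t -> (t - w) * tail F t <= (s - w) * tail F s].

(* If w is a best response to itself, profit vanishes on [w, +oo[, so the
   argmax is [w, +oo[ and is not compact: boundary responses only occur as
   limits of interior ones. *)
Definition well_posed (R : realType) (F : R -> R) (w : R) : Prop :=
  responses F w !=set0 /\ compact (responses F w).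

Definition edist_set (R : realType) (s : R) (S : set R) : \bar R :=
  ereal_inf [set `|s - r|%:E | r in S].

(** * Histories and the classes they determine *)

Record history (R : realType) (T : nat) := History {
  hw : 'I_T -> R;
  hs : 'I_T -> R;
  hq : 'I_T -> R }.

Definition valid_history (R : realType) (T : nat) (H : history R T) : Prop :=
  [/\ (forall i j : 'I_T, (i < j)%N -> hs H i < hs H j),
      (forall i j : 'I_T, (i < j)%N -> hq H j < hq H i),
      (forall i, 0 < hq H i < 1) &
      forall i, hw H i < hs H i].

Definition class_Q (R : realType) (T : nat) (al : R) (H : history R T) :
    set (R -> R) :=
  [set F | alpha_regular al F /\ forall i, tail F (hs H i) = hq H i].

Definition class_PE (R : realType) (T : nat) (al : R) (H : history R T)
    (eta : 'I_T -> R) : set (R -> R) :=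
  [set F | [/\ class_Q al H F,
               (forall i, well_posed F (hw H i)) &
               forall i, (edist_set (hs H i) (responses F (hw H i))
                          <= (eta i)%:E)%E]].

Definition current_prices (R : realType) (F : R -> R) (w0 eta0 : R) : set R :=
  [set y | w0 <= y /\ (edist_set y (responses F w0) <= eta0%:E)%E].

Definition outcomes (R : realType) (T : nat) (al : R) (H : history R T)
    (eta : 'I_T -> R) (w0 eta0 : R) : set ((R -> R) * R) :=
  [set Fy | [/\ class_PE al H eta Fy.1, well_posed Fy.1 w0 &
                current_prices Fy.1 w0 eta0 Fy.2]].

(* +oo when there is no outcome. *)
Definition qmin (R : realType) (T : nat) (al : R) (H : history R T)
    (eta : 'I_T -> R) (w0 eta0 : R) : \bar R :=
  ereal_inf [set (tail Fy.1 Fy.2)%:E | Fy in outcomes al H eta w0 eta0].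

Definition worst_case (R : realType) (T : nat) (al : R) (H : history R T)
    (eta : 'I_T -> R) (w0 eta0 : R) : set ((R -> R) * R) :=
  [set Fy | outcomes al H eta w0 eta0 Fy /\
            (tail Fy.1 Fy.2)%:E = qmin al H eta w0 eta0].

(** * Configurations *)

Record config (R : realType) (T : nat) := Config {
  lat_x : 'I_T -> R;
  lat_s : 'I_T -> R;
  lat_m : 'I_T -> R;
  cur_x : R;
  cur_r : R;
  cur_m : R;
  rea_x : R;
  rea_y : R }.

Definition configuration (R : realType) (T : nat) (al : R) (H : history R T)
    (eta : 'I_T -> R) (w0 eta0 : R) (p : config R T) : Prop :=
  [/\ forall i, [/\ 0 <= lat_x p i, 0 < lat_m p i,
        lat_s p i = hw H i + (1 + (1 - al) * lat_x p i) * lat_m p i &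
        `|lat_s p i - hs H i| <= eta i],
      [/\ 0 <= cur_x p, 0 < cur_m p &
        cur_r p = w0 + (1 + (1 - al) * cur_x p) * cur_m p] &
      [/\ 0 <= rea_x p, `|rea_y p - cur_r p| <= eta0 & w0 <= rea_y p]].

(* [inl (inl i)]: observed; [inl (inr i)]: latent; [inr false]: current exact;
   [inr true]: current realized. *)
Definition label (T : nat) : finType := ('I_T + 'I_T + bool)%type.

Definition node (R : realType) (T : nat) (al : R) (H : history R T)
    (p : config R T) (a : label T) : R * R :=
  match a with
  | inl (inl i) => (xcoord al (hq H i), hs H i)
  | inl (inr i) => (lat_x p i, lat_s p i)
  | inr false => (cur_x p, cur_r p)
  | inr true => (rea_x p, rea_y p)
  end.

Definition merged_nodes (R : realType) (T : nat) (al : R) (H : history R T)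
    (p : config R T) : seq (R * R) :=
  sort (fun u v => u.1 <= v.1) (undup [seq node al H p a | a : label T]).

(* Nodes are numbered from 1: the j-th one is [nth _ s j.-1]. *)
Definition nodeat (R : realType) (s : seq (R * R)) (j : nat) : R * R :=
  nth (0, 0) s j.-1.

Definition secant (R : realType) (s : seq (R * R)) (j : nat) : \bar R :=
  if j == 0%N then +oo%E
  else if (size s <= j)%N then 0%E
  else (((nodeat s j.+1).2 - (nodeat s j).2) /
        ((nodeat s j.+1).1 - (nodeat s j).1))%:E.

Definition slope_ok (R : realType) (s : seq (R * R)) (x mu : R) : Prop :=
  forall j, (1 <= j <= size s)%N -> (nodeat s j).1 = x ->
    (secant s j <= mu%:E <= secant s j.-1)%E.

Definition feasible (R : realType) (T : nat) (al : R) (H : history R T)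
    (p : config R T) : Prop :=
  let s := merged_nodes al H p in
  [/\ (forall a b, (node al H p a).1 = (node al H p b).1 ->
                   (node al H p a).2 = (node al H p b).2),
      (forall j, (1 <= j)%N -> (j.+1 < size s)%N ->
         (secant s j.+1 <= secant s j)%E),
      (0 < secant s (size s).-1)%E,
      (forall i, slope_ok s (lat_x p i) (lat_m p i)) &
      slope_ok s (cur_x p) (cur_m p)].

(** * Orderings *)

(* Weak orders on the labels; ties encode coincidences. *)
Definition ordering (T : nat) : finType := {ffun label T * label T -> bool}.

Definition price_order (R : realType) (T : nat) (al : R) (H : history R T)
    (p : config R T) : ordering T :=
  [ffun ab => (node al H p ab.1).2 <= (node al H p ab.2).2].

Definition Omega (R : realType) (T : nat) (al : R) (H : history R T)
    (eta : 'I_T -> R) (w0 eta0 : R) : set (ordering T) :=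
  [set price_order al H p | p in configuration al H eta w0 eta0].

Definition program (R : realType) (T : nat) (al : R) (H : history R T)
    (eta : 'I_T -> R) (w0 eta0 : R) (om : ordering T) : set (config R T) :=
  [set p | [/\ configuration al H eta w0 eta0 p, feasible al H p &
               price_order al H p = om]].

Definition realized_demand (R : realType) (T : nat) (al : R)
    (p : config R T) : R := Gammabar al (rea_x p).

(** * Generalized-Pareto curves *)

Record GP_piece (R : realType) := GPPiece {
  gp_a : R; gp_qa : R; gp_b : R; gp_qb : R }.

Definition valid_GP (R : realType) (g : GP_piece R) : Prop :=
  gp_a g < gp_b g /\ 0 < gp_qb g < gp_qa g /\ gp_qa g <= 1.

Definition Gbar (R : realType) (al : R) (g : GP_piece R) (v : R) : R :=
  let: GPPiece a qa b qb := g in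
  let l := a + (b - a) * (xcoord al (1 / qa) / xcoord al (qb / qa)) in
  if v < l then 1
  else qa * Gammabar al (xcoord al (qb / qa) * ((v - a) / (b - a))).

(* n + 1 pieces separated by the breakpoints t 1 < ... < t n. *)
Definition piecewise_Gbar_on (R : realType) (al : R) (D : set R)
    (Fb : R -> R) : Prop :=
  exists (n : nat) (t : nat -> R) (g : nat -> GP_piece R),
    [/\ (forall k, (1 <= k < n)%N -> t k < t k.+1),
        (forall k, (k <= n)%N -> valid_GP (g k)) &
        forall k s, (k <= n)%N -> D s ->
          ((1 <= k)%N -> t k <= s) -> ((k < n)%N -> s < t k.+1) ->
          Fb s = Gbar al (g k) s].

Definition piecewise_Gbar (R : realType) (al : R) (Fb : R -> R) : Prop :=
  piecewise_Gbar_on al [set: R] Fb.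

(* Finitely many pieces wherever demand stays above a positive level; pieces
   may accumulate only at the upper end of a bounded support. Every Gbar curve
   is positive everywhere, so a demand curve that vanishes at some price
   cannot be [piecewise_Gbar]. *)
Definition locally_piecewise_Gbar (R : realType) (al : R)
    (Fb : R -> R) : Prop :=
  forall c, 0 < c -> piecewise_Gbar_on al [set s | c <= Fb s] Fb.

(* Main.v *)
(* Writing a demand curve as [Gammabar al (X s)], with [X] the inverse of the
   price curve [v], regularity says that [X] is convex.  This is a comparison
   of the demand curve with the generalized-Pareto curve tangent to it; and by
   [1 - z <= Gammabar al z <= 1 / (1 + z)], a price [r] is optimal for [w] iff
   the line through [(x, r)] of slope [(r - w) / (1 + (1 - al) x)] supports [v].
   Hence feasibility of a configuration amounts to having at each node a
   supporting line of positive slope, the prescribed one at the optima.  Any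
   outcome with positive demand yields such a configuration (move the realized
   price to the exact optimum if demand there is [1]); conversely the lower
   envelope of the supporting lines is a piecewise generalized-Pareto curve
   realizing a configuration.  An outcome with zero demand is approached by
   configurations realizing prices close to the end of the support, and is
   reproduced by continuing the envelope with slopes decreasing geometrically. *)
Require Import Defs.
From HB Require Import structures.
From mathcomp Require Import all_boot all_order all_algebra.
From mathcomp Require Import all_classical all_reals all_analysis.
From mathcomp Require Import measurable_realfun zify ring lra.
Import Order.TTheory GRing.Theory Num.Theory.
Import numFieldNormedType.Exports.
Local Open Scope classical_set_scope.
Local Open Scope ring_scope.

Set Implicit Arguments.
Unset Strict Implicit.
Unset Printing Implicit Defensive.

(** The density is an arbitrary version, so the distribution function need not be differentiable at
    a given price, and a differential inequality between demand curves cannot simply be integrated.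
    Every passage between [f] and [F] therefore compares increments over short intervals, bounding
    the density there by monotone functions; the error is the length of the interval times an
    increment of one fixed function, and repeated bisection makes it vanish. The base point of a
    comparison is moved to 0 by [Gammabar al (x + (1 + (1 - al) * x) * z) = Gammabar al x * Gammabar
    al z], after which elementary bounds suffice: the lower one yields the first-order condition at
    an optimum, through a small price move, and the upper one yields global optimality. Regularity
    says nothing about prices with full demand, so these need separate arguments, by continuity or
    by using the optimality of the price. *)

(** Halving an interval halves the length factor while the increments of [V] telescope, so after [n]
    bisections the bound is divided by [2 ^ n]. This stands in for a derivative test and asks no
    smoothness of [Z] or [V]. *)
Lemma le_of_quadratic_increments (R : realType) (Z V : R -> R) (a b : R) :
  a <= b ->
  (forall s t, a <= s -> s <= t -> t <= b ->
    Z t - Z s <= (t - s) * (V t - V s)) ->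
  Z b <= Z a.
Proof.
move=> ab hZ.
have bisect n s t : a <= s -> s <= t -> t <= b ->
    Z t - Z s <= 2^-1 ^+ n * ((t - s) * (V t - V s)).
  elim: n s t => [|n IH] s t as_ st tb; first by rewrite expr0 mul1r; exact: hZ.
  pose m := (s + t) / 2.
  have sm : s <= m by rewrite /m; lra.
  have mt : m <= t by rewrite /m; lra.
  have h1 := IH s m as_ sm (le_trans mt tb).
  have h2 := IH m t (le_trans as_ sm) mt tb.
  have E : 2^-1 ^+ n.+1 * ((t - s) * (V t - V s)) =
      2^-1 ^+ n * ((m - s) * (V m - V s)) +
      2^-1 ^+ n * ((t - m) * (V t - V m)).
    by rewrite exprS /m; field.
  rewrite E; lra.
rewrite -subr_le0; apply/ler_addgt0Pl => e e0; rewrite addr0.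
set K := (b - a) * (V b - V a).
have [K0|K0] := leP K 0.
  by apply: le_trans (hZ a b (lexx _) ab (lexx _)) _; apply: le_trans K0 (ltW e0).
have [n hn] : exists n : nat, K / e < 2 ^+ n.
  exists (Num.truncn (K / e)).+1; apply: lt_le_trans (truncnS_gt _) _.
  by rewrite -natrX ler_nat ltnW // ltn_expl.
apply: le_trans (bisect n a b (lexx _) ab (lexx _)) _.
rewrite -/K exprVn mulrC ler_pdivrMr ?exprn_gt0 //.
by rewrite mulrC; apply/ltW; rewrite -ltr_pdivrMr.
Qed.

(** * Generalized-Pareto tails *)

Lemma Gammabar0 (R : realType) (al : R) : Gammabar al 0 = 1.
Proof.
by rewrite /Gammabar mulr0 addr0 powR1 oppr0 expR0; case: ifP.
Qed.

Section GeneralizedPareto.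
Variables (R : realType) (al : R).
Hypothesis hal : 0 <= al <= 1.

Let be_ge0 : 0 <= 1 - al. Proof. by rewrite subr_ge0; case/andP: hal. Qed.

Lemma gp_dom_ge0 (x : R) : 0 <= x -> 1 <= 1 + (1 - al) * x.
Proof. by move=> x0; rewrite lerDl mulr_ge0. Qed.

Lemma Gammabar_gt0 (x : R) : 0 < 1 + (1 - al) * x -> 0 < Gammabar al x.
Proof.
by move=> h; rewrite /Gammabar; case: ifP => _; rewrite ?expR_gt0 ?powR_gt0.
Qed.

(** Stability of generalized-Pareto tails under conditioning: [1 + (1 - al) * t] is multiplicative
    for this composition of [x] and [z]. *)
Lemma Gammabar_scale (x z : R) :
  0 < 1 + (1 - al) * x -> 0 < 1 + (1 - al) * z ->
  Gammabar al (x + (1 + (1 - al) * x) * z) = Gammabar al x * Gammabar al z.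
Proof.
move=> hx hz; rewrite /Gammabar; case: eqVneq => [->|_].
  by rewrite -expRD; congr expR; ring.
rewrite -powRM ?ltW //; congr (_ `^ _); ring.
Qed.

Lemma Gammabar_ge_expR (z : R) : 0 < 1 + (1 - al) * z ->
  expR (- z) <= Gammabar al z.
Proof.
move=> hz; rewrite /Gammabar; case: eqVneq => [//|al1].
have b0 : 0 < 1 - al by rewrite lt_neqAle be_ge0 andbT eq_sym subr_eq0 eq_sym.
rewrite /powR gt_eqF // ler_expR mulNr lerN2 ler_pdivrMl //.
by apply: le_ln1Dx; rewrite -subr_gt0 opprK addrC.
Qed.

Lemma Gammabar_ge (z : R) : 0 < 1 + (1 - al) * z -> 1 - z <= Gammabar al z.
Proof.
by move=> hz; apply: le_trans (Gammabar_ge_expR hz); exact: expR_ge1Dx.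
Qed.

(* Bernoulli's inequality [(1 + z)^be <= 1 + be z] with [be = 1 - al]. *)
Lemma Gammabar_le (z : R) : 0 < 1 + (1 - al) * z ->
  (1 + z) * Gammabar al z <= 1.
Proof.
move=> hz; have [z1|z1] := leP (1 + z) 0.
  apply: (@le_trans _ _ 0) => //.
  by rewrite mulr_le0_ge0 // ltW // Gammabar_gt0.
rewrite -ler_pdivlMr ?Gammabar_gt0 // div1r /Gammabar.
case: eqVneq => [al1|al1]; first by rewrite expRN invrK expR_ge1Dx.
have b0 : 0 < 1 - al by rewrite lt_neqAle be_ge0 andbT eq_sym subr_eq0 eq_sym.
rewrite powRN invrK.
set b := 1 - al in b0 hz *; set a := ln (1 + z).
have ea : expR a = 1 + z by rewrite /a lnK.
(* The tangent inequalities of [expR] at [(1 - b) * a] and at [- (b * a)], taken with weights [b]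
   and [1 - b]: the terms linear in [a] cancel. *)
have key : expR (b * a) <= 1 + b * z.
  have h1 := expR_ge1Dx ((1 - b) * a); have h2 := expR_ge1Dx (- (b * a)).
  have e1 : expR a = expR (b * a) * expR ((1 - b) * a).
    by rewrite -expRD; congr expR; ring.
  have e2 : 1 = expR (b * a) * expR (- (b * a)) by rewrite -expRD subrr expR0.
  have -> : z = expR a - 1 by rewrite ea; ring.
  have p := expR_gt0 (b * a).
  rewrite mulrBr mulr1; move: h1; rewrite -(ler_pM2l p) -e1 => h1.
  move: h2; rewrite -(ler_pM2l p) -e2 => h2.
  have b1 : 0 <= 1 - b by rewrite /b opprB addrC subrK; case/andP: hal.
  have := lerD (ler_wpM2l (ltW b0) h1) (ler_wpM2l b1 h2).
  lra.
rewrite -{1}ea /powR gt_eqF // ler_expR mulrC ler_pdivlMr // mulrC.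
by rewrite -ler_expR lnK.
Qed.

Lemma Gammabar_lt (x y : R) : 0 < 1 + (1 - al) * x -> x < y ->
  Gammabar al y < Gammabar al x.
Proof.
move=> hx xy; set e := 1 + (1 - al) * x in hx.
pose z := (y - x) / e.
have z0 : 0 < z by rewrite divr_gt0 // subr_gt0.
have hz : 0 < 1 + (1 - al) * z.
  by apply: lt_le_trans (gp_dom_ge0 (ltW z0)).
have -> : y = x + e * z by rewrite /z mulrC divfK ?gt_eqF // addrC subrK.
rewrite Gammabar_scale // -[ltRHS]mulr1 ltr_pM2l ?Gammabar_gt0 //.
have := Gammabar_le hz; have := Gammabar_gt0 hz.
rewrite mulrDl mul1r => g0 h; rewrite (lt_le_trans _ h) // ltrDl.
exact: mulr_gt0.
Qed.

Lemma Gammabar_mono (x y : R) : 0 < 1 + (1 - al) * x -> x <= y ->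
  Gammabar al y <= Gammabar al x.
Proof.
by move=> hx; rewrite le_eqVlt => /predU1P[->//|/(Gammabar_lt hx)/ltW].
Qed.

Lemma Gammabar_le1 (x : R) : 0 <= x -> Gammabar al x <= 1.
Proof. by move=> x0; rewrite -(Gammabar0 al) Gammabar_mono // mulr0 addr0. Qed.

Lemma Gammabar_lt1 (x : R) : 0 < x -> Gammabar al x < 1.
Proof. by move=> x0; rewrite -(Gammabar0 al) Gammabar_lt // mulr0 addr0. Qed.

Lemma xcoord_dom (q : R) : 0 < q -> 0 < 1 + (1 - al) * xcoord al q.
Proof.
move=> q0; rewrite /xcoord; case: eqVneq => [->|al1].
  by rewrite subrr mul0r addr0.
have h : 1 - al != 0 by rewrite subr_eq0 eq_sym.
by rewrite mulrC divfK // addrC subrK powR_gt0.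
Qed.

Lemma xcoord_le (x q : R) : 0 < q -> 0 < 1 + (1 - al) * x ->
  (x <= xcoord al q) = (q <= Gammabar al x).
Proof.
move=> q0 hx; apply/idP/idP => h.
  by rewrite -[leLHS](GammabarK al) // Gammabar_mono.
rewrite leNgt; apply/negP => hl.
have := Gammabar_lt (xcoord_dom q0) hl; rewrite GammabarK //.
by rewrite ltNge h.
Qed.

Lemma xcoord_ge0 (q : R) : 0 < q -> (0 <= xcoord al q) = (q <= 1).
Proof. by move=> q0; rewrite xcoord_le ?mulr0 ?addr0 // Gammabar0. Qed.

Lemma xcoord1 : xcoord al 1 = 0.
Proof. by rewrite -(Gammabar0 al) xcoordK // mulr0 addr0. Qed.

Lemma Gammabar_small (c : R) : 0 < c -> exists2 C, 0 <= C &
  forall x, C <= x -> Gammabar al x < c.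
Proof.
(* By [Gammabar_le] the tail at [x] is at most [1 / (1 + x)]. *)
move=> c0; exists c^-1; first by rewrite invr_ge0 ltW.
move=> x cx; have x0 : 0 < x by apply: lt_le_trans cx; rewrite invr_gt0.
have hx : 0 < 1 + (1 - al) * x by apply: lt_le_trans (gp_dom_ge0 (ltW x0)).
have := Gammabar_le hx; rewrite -ler_pdivlMl; last lra.
move/le_lt_trans; apply; rewrite mulr1 invf_plt ?posrE //; lra.
Qed.

End GeneralizedPareto.

(** * Distribution functions with a density *)

Section IntervalIntegrals.
Variables (R : realType) (f : R -> R).
Hypotheses (mf : measurable_fun [set: R] f) (f0 : forall x, 0 <= f x).
Let mu := @lebesgue_measure R.

Let mfE (D : set R) : measurable_fun D (fun x => (f x)%:E).
Proof.
apply: (@measurable_funS _ _ _ _ setT) => //.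
by apply/measurable_EFinP.
Qed.

Lemma integral_Nyc_split (s t : R) : s <= t ->
  (\int[mu]_(x in `]-oo, t]) (f x)%:E =
   \int[mu]_(x in `]-oo, s]) (f x)%:E + \int[mu]_(x in `]s, t]) (f x)%:E)%E.
Proof.
move=> st; rewrite (@itv_bndbnd_setU _ _ -oo%O (BRight s) (BRight t)) //.
rewrite ge0_integral_setU //=.
- exact: mfE.
- by move=> x _; rewrite lee_fin.
- apply/disj_setPS => x [/=]; rewrite !in_itv /= => xs /andP[sx _].
  by move: xs; rewrite leNgt sx.
Qed.

Lemma integral_oc_ge (s t m : R) : s <= t -> 0 <= m ->
  (forall u, s < u -> u <= t -> m <= f u) ->
  ((m * (t - s))%:E <= \int[mu]_(x in `]s, t]) (f x)%:E)%E.
Proof.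
move=> st m0 h.
have -> : (m * (t - s))%:E = (\int[mu]_(x in `]s, t]) cst m%:E x)%E.
  rewrite integral_cst //= lebesgue_measure_itv /= lte_fin.
  move: st; rewrite le_eqVlt => /predU1P[->|st].
    by rewrite ltxx subrr mulr0 mule0.
  by rewrite st -EFinB -EFinM.
apply: ge0_le_integral => //=.
- exact: mfE.
- move=> x; rewrite in_itv /= => /andP[sx xt]; rewrite lee_fin; exact: h.
Qed.

Lemma integral_oc_le (s t M : R) : s <= t ->
  (forall u, s < u -> u <= t -> f u <= M) ->
  (\int[mu]_(x in `]s, t]) (f x)%:E <= (M * (t - s))%:E)%E.
Proof.
move=> st h.
have -> : (M * (t - s))%:E = (\int[mu]_(x in `]s, t]) cst M%:E x)%E.
  rewrite integral_cst //= lebesgue_measure_itv /= lte_fin.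
  move: st; rewrite le_eqVlt => /predU1P[->|st].
    by rewrite ltxx subrr mulr0 mule0.
  by rewrite st -EFinB -EFinM.
apply: ge0_le_integral => //=.
- by move=> x _; rewrite lee_fin.
- exact: mfE.
- move=> x; rewrite in_itv /= => /andP[sx xt]; rewrite lee_fin; exact: h.
Qed.

End IntervalIntegrals.

Section DistributionFunctions.
Variables (R : realType) (F f : R -> R).
Hypothesis dF : has_density F f.
Let mu := @lebesgue_measure R.

Lemma has_density_increment (s t : R) : s <= t ->
  ((F t - F s)%:E = \int[mu]_(x in `]s, t]) (f x)%:E)%E.
Proof.
case: dF => mf f0 _ FE st.
have := integral_Nyc_split mf f0 st; rewrite -!FE => h.
by rewrite EFinB h addeAC subee // add0e.
Qed.

Lemma cdf_mono (s t : R) : s <= t -> F s <= F t.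
Proof.
case: (dF) => mf f0 _ FE st; rewrite -subr_ge0 -lee_fin.
by rewrite has_density_increment //; apply: integral_ge0 => x _; rewrite lee_fin.
Qed.

Lemma tail_mono (s t : R) : s <= t -> tail F t <= tail F s.
Proof. by move=> st; rewrite /tail lerD2l lerN2 cdf_mono. Qed.

Lemma tail_ge0 (s : R) : 0 <= tail F s.
Proof.
case: dF => mf f0 I1 FE; rewrite /tail subr_ge0 -lee_fin FE -I1.
apply: ge0_subset_integral => //.
- by apply: measurableT_comp.
- by move=> x _; rewrite lee_fin.
Qed.

Lemma tail_le1 (s : R) : tail F s <= 1.
Proof.
case: dF => mf f0 I1 FE; rewrite /tail lerBlDr lerDl -lee_fin FE.
by apply: integral_ge0 => x _; rewrite lee_fin.
Qed.

Lemma tail_decrementE (s t : R) : tail F s - tail F t = F t - F s.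
Proof. by rewrite /tail; ring. Qed.

Lemma tail_decrement_ge (s t m : R) : s <= t -> 0 <= m ->
  (forall u, s < u -> u <= t -> m <= f u) -> m * (t - s) <= tail F s - tail F t.
Proof.
case: (dF) => mf f0 I1 FE st m0 h; rewrite tail_decrementE.
rewrite -lee_fin has_density_increment //; exact: integral_oc_ge.
Qed.

Lemma tail_decrement_le (s t M : R) : s <= t ->
  (forall u, s < u -> u <= t -> f u <= M) -> tail F s - tail F t <= M * (t - s).
Proof.
case: (dF) => mf f0 I1 FE st h; rewrite tail_decrementE.
rewrite -lee_fin has_density_increment //; exact: integral_oc_le.
Qed.

Lemma tail_continuous : continuous (tail F).
Proof.
case: (dF) => mf f0 I1 FE x; apply/cvgrPdist_lt => e e0.
have intf : mu.-integrable setT (EFin \o f).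
  apply/integrableP; split; first by apply: measurableT_comp.
  under eq_integral do rewrite /= ger0_norm //.
  by rewrite I1 ltry.
have [d [d0 hd]] := integral_normr_continuous intf e0.
near=> y.
have yx : `|x - y| < d by near: y; apply: cvgr_dist_lt.
have key (s t : R) : s <= t -> t - s < d -> `|tail F s - tail F t| < e.
  move=> st ts; rewrite ger0_norm; last by rewrite subr_ge0 tail_mono.
  rewrite tail_decrementE.
  have -> : F t - F s = \int[mu]_(x in `]s, t]) `|f x|.
    rewrite /Rintegral; under eq_integral do rewrite ger0_norm //.
    by rewrite -has_density_increment.
  have mst : (mu `]s, t] < d%:E)%E.
    by rewrite /mu lebesgue_measure_itv /= lte_fin; case: ifPn => _; rewrite lte_fin.
  exact: hd (measurable_itv _) mst.
have [xy|/ltW xy] := leP x y.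
- by apply: key => //; rewrite distrC in yx; apply: le_lt_trans yx; rewrite ler_norm.
- by rewrite distrC; apply: key => //; apply: le_lt_trans yx; rewrite ler_norm.
Unshelve. all: by end_near.
Qed.

Lemma tail_value (s t c : R) : s <= t -> tail F t <= c -> c <= tail F s ->
  exists2 u, s <= u <= t & tail F u = c.
Proof.
move=> st tc cs.
have cont : {within `[s, t], continuous (tail F)}.
  by apply: continuous_subspaceT; exact: tail_continuous.
have [|u us uc] := IVT st cont (v := c).
  by rewrite (min_r (tail_mono st)) (max_l (tail_mono st)) tc.
by exists u.
Qed.

End DistributionFunctions.

(** * Convexity of regular curves *)

Lemma ln_diff_le (R : realType) (a b : R) : 0 < a -> 0 < b ->
  ln a - ln b <= (a - b) / b.
Proof.
move=> a0 b0; rewrite -ln_div ?posrE //.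
have -> : a / b = 1 + (a - b) / b by rewrite mulrBl divff ?gt_eqF // addrC subrK.
apply: le_ln1Dx; rewrite mulrBl divff ?gt_eqF // ltrBrDl subrr; exact: divr_gt0.
Qed.

Section RegularCurves.
Variables (R : realType) (al : R) (F f : R -> R).
Hypotheses (hal : 0 <= al <= 1) (dF : has_density F f).
Hypothesis fpos : forall s, 0 < tail F s < 1 -> 0 < f s.
Hypothesis reg : forall s t, 0 < tail F s < 1 -> 0 < tail F t < 1 -> s <= t ->
  (1 - al) * s - tail F s / f s <= (1 - al) * t - tail F t / f t.
Local Notation q := (tail F).
Local Notation X := (fun s => xcoord al (tail F s)).

Let be_ge0 : 0 <= 1 - al. Proof. by rewrite subr_ge0; case/andP: hal. Qed.

(** The logarithm of the comparison curve is convex with derivative [- 1 / H u], and this is its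
    tangent inequality at [u]. Taking [u] as base point reduces it to [Gammabar_ge_expR]. *)
Lemma gp_log_decay (s h u v : R) : 0 < h ->
  0 < h + (1 - al) * (u - s) -> 0 < h + (1 - al) * (v - s) ->
  ln (Gammabar al ((u - s) / h)) - (v - u) / (h + (1 - al) * (u - s)) <=
  ln (Gammabar al ((v - s) / h)).
Proof.
move=> h0 Hu Hv.
have E w : 1 + (1 - al) * ((w - s) / h) = (h + (1 - al) * (w - s)) / h.
  by field; rewrite gt_eqF.
set Hu' := h + _ in Hu *; set z := (v - u) / Hu'.
have hz : 0 < 1 + (1 - al) * z.
  suff -> : 1 + (1 - al) * z = (h + (1 - al) * (v - s)) / Hu' by rewrite divr_gt0.
  by rewrite /z /Hu'; field; rewrite gt_eqF.
have du : 0 < 1 + (1 - al) * ((u - s) / h) by rewrite E divr_gt0.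
have -> : (v - s) / h = (u - s) / h + (1 + (1 - al) * ((u - s) / h)) * z.
  rewrite E -/Hu' /z; field; rewrite !gt_eqF //.
rewrite Gammabar_scale // lnM ?posrE ?Gammabar_gt0 // lerD2l -[leLHS]expRK.
by rewrite ler_ln ?posrE ?expR_gt0 ?Gammabar_gt0 // Gammabar_ge_expR.
Qed.

(* [Gammabar ((u - s) / h)] solves [P' = - P / H] with
   [H u = h + (1 - al) * (u - s)]; the next two lemmas compare the demand
   curve with it on either side of [s]. *)
Lemma tail_le_gp_right (s t h : R) : s <= t -> 0 < h -> 0 < q t ->
  (forall u, s < u -> u <= t -> q u / (h + (1 - al) * (u - s)) <= f u) ->
  q t <= q s * Gammabar al ((t - s) / h).
Proof.
move=> st h0 qt0 hf; pose H u := h + (1 - al) * (u - s).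
pose P u := Gammabar al ((u - s) / h).
have H0 u : s <= u -> 0 < H u.
  by move=> su; apply: ltr_wpDr => //; rewrite mulr_ge0 // subr_ge0.
have q0 u : u <= t -> 0 < q u by move=> ut; apply: lt_le_trans (tail_mono dF ut).
have P0 u : s <= u -> 0 < P u.
  move=> su; apply: Gammabar_gt0; apply: lt_le_trans (gp_dom_ge0 hal _) => //.
  by rewrite divr_ge0 ?subr_ge0 // ltW.
have Hle u v : u <= v -> H u <= H v.
  by move=> uv; rewrite lerD2l ler_wpM2l // lerD2r.
have W u v : s <= u -> u <= v -> v <= t -> q v / H v <= q u / H u.
  move=> su uv vt; apply: ler_pM.
  - by rewrite ltW // q0.
  - by rewrite invr_ge0 ltW // H0 // (le_trans su).
  - exact: (tail_mono dF).
  - by rewrite lef_pV2 ?posrE ?H0 ?Hle // (le_trans su).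
(* Formally [ln q - ln P] has derivative [- f / q + 1 / H <= 0]. Both parts of its increment are
   controlled by [q / H], which is nonincreasing, and this dictates the function [V]. *)
have Z : ln (q t) - ln (P t) <= ln (q s) - ln (P s).
  apply: (@le_of_quadratic_increments _ (fun u => ln (q u) - ln (P u))
    (fun u => - (q u / H u) / q t)) => // u v su uv vt.
  have sv := le_trans su uv; have ut := le_trans uv vt.
  have h1 : ln (q v) - ln (q u) <= - ((q v / H v) * (v - u)) / q u.
    apply: le_trans (ln_diff_le (q0 _ vt) (q0 _ ut)) _.
    rewrite ler_pM2r ?invr_gt0 ?q0 // -opprB lerN2.
    apply: (tail_decrement_ge dF) => //.
      by rewrite divr_ge0 // ltW ?q0 ?H0.
    move=> w uw wv; apply: le_trans (hf w _ _); last 2 first.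
    - exact: le_lt_trans su uw.
    - exact: le_trans wv vt.
    by apply: W => //; apply: ltW; exact: le_lt_trans su uw.
  have h2 : ln (P u) - (v - u) / H u <= ln (P v) by apply: gp_log_decay => //; exact: H0.
  have h3 : (v - u) / H u - (q v / H v) * (v - u) / q u =
      (v - u) * ((q u / H u - q v / H v) / q u).
    by field; rewrite !gt_eqF ?q0 ?H0.
  have h4 : (q u / H u - q v / H v) / q u <= (q u / H u - q v / H v) / q t.
    apply: ler_wpM2l; first by rewrite subr_ge0 W.
    by rewrite lef_pV2 ?posrE ?q0 // (tail_mono dF).
  have h5 : (v - u) * ((q u / H u - q v / H v) / q u) <=
      (v - u) * (- (q v / H v) / q t - - (q u / H u) / q t).
    apply: ler_wpM2l; first by rewrite subr_ge0.
    by apply: le_trans h4 _; rewrite -mulrBl opprK addrC.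
  by apply: le_trans h5; rewrite -h3; rewrite mulNr in h1; lra.
have Ps : P s = 1 by rewrite /P subrr mul0r Gammabar0.
rewrite Ps ln1 subr0 lerBlDr -lnM ?posrE ?P0 ?q0 // in Z.
by rewrite ler_ln ?posrE ?mulr_gt0 ?q0 ?P0 // in Z.
Qed.

Lemma tail_le_gp_left (s t h : R) : t <= s -> 0 < h -> 0 < q s ->
  0 < h + (1 - al) * (t - s) ->
  (forall u, t < u -> u <= s -> f u <= q u / (h + (1 - al) * (u - s))) ->
  q t <= q s * Gammabar al ((t - s) / h).
Proof.
move=> ts h0 qs0 Ht hf; pose H u := h + (1 - al) * (u - s).
pose P u := Gammabar al ((u - s) / h).
have Hle u v : u <= v -> H u <= H v.
  by move=> uv; rewrite lerD2l ler_wpM2l // lerD2r.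
have H0 u : t <= u -> 0 < H u by move=> tu; apply: lt_le_trans (Hle _ _ tu).
have q0 u : u <= s -> 0 < q u by move=> us; apply: lt_le_trans (tail_mono dF us).
have P0 u : t <= u -> 0 < P u.
  move=> tu; apply: Gammabar_gt0.
  have -> : 1 + (1 - al) * ((u - s) / h) = H u / h by rewrite /H; field; rewrite gt_eqF.
  by rewrite divr_gt0 ?H0.
have W u v : t <= u -> u <= v -> v <= s -> q v / H v <= q u / H u.
  move=> tu uv vs; apply: ler_pM.
  - by rewrite ltW // q0.
  - by rewrite invr_ge0 ltW // H0 // (le_trans tu).
  - exact: (tail_mono dF).
  - by rewrite lef_pV2 ?posrE ?H0 ?Hle // (le_trans tu).
(* The mirror image: [f] is now bounded above by [q / H], so it is [ln P - ln q] that decreases, up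
   to the value at the right end [s]. *)
have Z : ln (P s) - ln (q s) <= ln (P t) - ln (q t).
  apply: (@le_of_quadratic_increments _ (fun u => ln (P u) - ln (q u))
    (fun u => - (q u / H u) / q s)) => // u v tu uv vs.
  have tv := le_trans tu uv; have us := le_trans uv vs.
  have h1 : ln (q u) - ln (q v) <= ((q u / H u) * (v - u)) / q v.
    apply: le_trans (ln_diff_le (q0 _ us) (q0 _ vs)) _.
    rewrite ler_pM2r ?invr_gt0 ?q0 //.
    apply: (tail_decrement_le dF) => //.
    move=> w uw wv; apply: le_trans (hf w _ _) _.
    - exact: le_lt_trans tu uw.
    - exact: le_trans wv vs.
    by apply: W => //; [exact: ltW | exact: le_trans wv vs].
  have h2 : ln (P v) - (u - v) / H v <= ln (P u).
    by apply: gp_log_decay => //; exact: H0.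
  have h3 : (u - v) / H v + (q u / H u) * (v - u) / q v =
      (v - u) * ((q u / H u - q v / H v) / q v).
    by field; rewrite !gt_eqF ?q0 ?H0.
  have h4 : (q u / H u - q v / H v) / q v <= (q u / H u - q v / H v) / q s.
    apply: ler_wpM2l; first by rewrite subr_ge0 W.
    by rewrite lef_pV2 ?posrE ?q0 // (tail_mono dF).
  have h5 : (v - u) * ((q u / H u - q v / H v) / q v) <=
      (v - u) * (- (q v / H v) / q s - - (q u / H u) / q s).
    apply: ler_wpM2l; first by rewrite subr_ge0.
    by apply: le_trans h4 _; rewrite -mulrBl opprK addrC.
  by apply: le_trans h5; rewrite -h3; lra.
have Ps : P s = 1 by rewrite /P subrr mul0r Gammabar0.
have {Z} : ln (q t) <= ln (q s) + ln (P t) by move: Z; rewrite Ps ln1; lra.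
rewrite -lnM ?posrE ?P0 ?q0 //.
by rewrite ler_ln ?posrE ?mulr_gt0 ?q0 ?P0.
Qed.

(** The slope is the formal derivative of [X] at [s]. Regularity between [s] and [u] bounds
    [q u / f u] by [h + (1 - al) * (u - s)], from above to the right of [s] and from below to its
    left, which is what the two comparison lemmas ask for. *)
Lemma regular_subgradient_lt1 (s t : R) : 0 < q s < 1 -> 0 < q t < 1 ->
  X s + (t - s) * ((1 + (1 - al) * X s) * (f s / q s)) <= X t.
Proof.
move=> qs qt; have fs := fpos qs.
have /andP[qs0 qs1] := qs; have /andP[qt0 qt1] := qt.
pose h := q s / f s; have h0 : 0 < h by rewrite divr_gt0.
set e := 1 + _; have e0 : 0 < e by exact: xcoord_dom.
pose z := (t - s) / h.
have -> : X s + (t - s) * (e * (f s / q s)) = X s + e * z.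
  by rewrite /z /h; field; rewrite !gt_eqF.
have hE : 1 + (1 - al) * (X s + e * z) = e * (1 + (1 - al) * z) by rewrite /e; ring.
have zE : 1 + (1 - al) * z = (h + (1 - al) * (t - s)) / h.
  by rewrite /z; field; rewrite gt_eqF.
(* If the tangent has left the domain of [Gammabar] at [t], it lies below every value that [X] can
   take. *)
have [Ht|Ht] := ltP 0 (h + (1 - al) * (t - s)); last first.
  rewrite leNgt; apply/negP => lt.
  have : 1 + (1 - al) * X t <= 1 + (1 - al) * (X s + e * z).
    by rewrite lerD2l ler_wpM2l // ltW.
  rewrite hE zE leNgt => /negP; apply.
  have qtd := xcoord_dom al qt0; apply: (@le_lt_trans _ _ 0) => //.
  by rewrite mulr_ge0_le0 ?(ltW e0) // mulr_le0_ge0 // invr_ge0 ltW.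
have dz : 0 < 1 + (1 - al) * z by rewrite zE divr_gt0.
rewrite xcoord_le //; last by rewrite hE mulr_gt0.
rewrite Gammabar_scale // GammabarK //.
have [st|ts] := leP s t.
- apply: tail_le_gp_right => // u su ut.
  have qu0 : 0 < q u by apply: lt_le_trans (tail_mono dF ut).
  have qu : 0 < q u < 1.
    by rewrite qu0 (le_lt_trans (tail_mono dF (ltW su))).
  have Hu : 0 < h + (1 - al) * (u - s).
    by apply: ltr_wpDr => //; rewrite mulr_ge0 // subr_ge0 ltW.
  rewrite ler_pdivrMr // mulrC -ler_pdivrMr ?fpos //.
  have := reg qs qu (ltW su); rewrite -/h; lra.
- apply: tail_le_gp_left => //; first exact: ltW.
  move=> u tu us.
  have qu : 0 < q u < 1.
    rewrite (lt_le_trans qs0 (tail_mono dF us)).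
    by rewrite (le_lt_trans (tail_mono dF (ltW tu))).
  have Hu : 0 < h + (1 - al) * (u - s).
    by apply: lt_le_trans Ht _; rewrite lerD2l ler_wpM2l // lerD2r ltW.
  rewrite ler_pdivlMr // mulrC -ler_pdivlMr ?fpos //.
  have := reg qu qs us; rewrite -/h; lra.
Qed.

(** Adds the prices [t] with full demand, where [X t = 0]. Were the tangent at some height [Y > 0]
    there, continuity would give [u] between [t] and [s] with [X u = Y / 2]; the tangent at [u] is
    at least [Y], against the previous lemma. *)
Lemma regular_subgradient (s t : R) : 0 < q s < 1 -> 0 < q t ->
  X s + (t - s) * ((1 + (1 - al) * X s) * (f s / q s)) <= X t.
Proof.
move=> qs qt0; have [qt1|qt1] := ltP (q t) 1.
  by apply: regular_subgradient_lt1 => //; rewrite qt0.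
have {qt1} qt1 : q t = 1 by apply/le_anti; rewrite qt1 (tail_le1 dF).
have /andP[qs0 qs1] := qs.
have ts : t < s.
  by rewrite ltNge; apply/negP => /(tail_mono dF); rewrite qt1 leNgt qs1.
set g := _ * (f s / q s); have g0 : 0 < g.
  by rewrite mulr_gt0 ?divr_gt0 ?xcoord_dom ?fpos.
rewrite qt1 xcoord1 leNgt; apply/negP; set Y := _ + _ => Y0.
have h1 : 0 < 1 + (1 - al) * (Y / 2).
  by apply: lt_le_trans (gp_dom_ge0 hal _) => //; rewrite divr_ge0 // ltW.
have YX : Y < X s by rewrite gtrDl nmulr_rlt0 // subr_lt0.
have [u /andP[tu us] qu] : exists2 u, t <= u <= s & q u = Gammabar al (Y / 2).
  apply: (tail_value dF) => //; first exact: ltW.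
    by rewrite -xcoord_le // ltW //; apply: lt_trans YX; lra.
  by rewrite qt1 Gammabar_le1 // divr_ge0 // ltW.
have := @regular_subgradient_lt1 s u qs.
rewrite qu Gammabar_gt0 // Gammabar_lt1 ?divr_gt0 // => /(_ isT).
rewrite xcoordK // -/g.
have : (t - s) * g <= (u - s) * g by rewrite ler_pM2r // lerD2r.
rewrite /Y in Y0 *; lra.
Qed.

(** Unlike the subgradient inequality, the chord inequality is available at an endpoint with full
    demand; a response may be such a price. *)
Lemma xcoord_tail_convex (s t l : R) : 0 < q s -> 0 < q t -> 0 <= l <= 1 ->
  X (s + l * (t - s)) <= X s + l * (X t - X s).
Proof.
move=> qs0 qt0 /andP[l0 l1]; set u := s + _.
have qu0 : 0 < q u.
  have [st|ts] := leP s t.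
    apply: lt_le_trans qt0 (tail_mono dF _).
    by have : l * (t - s) <= 1 * (t - s); [rewrite ler_wpM2r // subr_ge0|rewrite /u; lra].
  apply: lt_le_trans qs0 (tail_mono dF _).
  by rewrite gerDl mulr_ge0_le0 // subr_le0 ltW.
have [qu1|qu1] := ltP (q u) 1; last first.
  have -> : q u = 1 by apply/le_anti; rewrite qu1 (tail_le1 dF).
  have Xs : 0 <= X s by rewrite xcoord_ge0 // (tail_le1 dF).
  have Xt : 0 <= X t by rewrite xcoord_ge0 // (tail_le1 dF).
  rewrite xcoord1.
  have -> : X s + l * (X t - X s) = (1 - l) * X s + l * X t by ring.
  by rewrite addr_ge0 // mulr_ge0 // subr_ge0.
have qu : 0 < q u < 1 by rewrite qu0.
have := regular_subgradient qu qs0; have := regular_subgradient qu qt0.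
set g := (1 + (1 - al) * X u) * (f u / q u); move=> ht hs.
have l1' : 0 <= 1 - l by rewrite subr_ge0.
have := lerD (ler_wpM2l l0 ht) (ler_wpM2l l1' hs).
have -> : l * (xcoord al (q u) + (t - u) * g) +
  (1 - l) * (xcoord al (q u) + (s - u) * g) = xcoord al (q u) by rewrite /u; ring.
lra.
Qed.

(** First-order condition by perturbation. Moving the price from [s] by a fraction [l] of the way to
    [t] raises [X] by at most [l * A], and [1 - z <= Gammabar al z] bounds the resulting profit from
    below. Optimality then gives [d * e <= (p + l * d) * A], which fails for small [l] if
    [d * e > A * p]. *)
Lemma response_supports (w s t : R) : responses F w s -> w < s -> 0 < q s ->
  0 < q t -> t <= s + (s - w) / (1 + (1 - al) * X s) * (X t - X s).
Proof.
move=> [_ opt] ws qs0 qt0; set e := 1 + _; have e0 : 0 < e by exact: xcoord_dom.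
set A := X t - X s; set d := t - s; set p := s - w.
have p0 : 0 < p by rewrite subr_gt0.
suff : d * e <= A * p.
  move=> h; rewrite -lerBlDl -/d.
  have -> : p / e * A = A * p / e by field; rewrite gt_eqF.
  by rewrite ler_pdivlMr.
rewrite leNgt; apply/negP => gap0; set gap := d * e - A * p.
have {}gap0 : 0 < gap by rewrite subr_gt0.
(* The three terms ensure in turn [l <= 1], [l * |A * d| < gap], and a perturbed price above [w]. *)
pose D := 1 + `|A * d| / gap + `|d| / p.
have hA : 0 <= `|A * d| / gap by rewrite divr_ge0 // ltW.
have hd : 0 <= `|d| / p by rewrite divr_ge0 // ltW.
have D0 : 0 < D by rewrite /D; lra.
pose l := D^-1; have l0 : 0 < l by rewrite invr_gt0.
have l1 : l <= 1 by rewrite invf_le1 // /D; lra.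
have lA : l * `|A * d| < gap.
  rewrite mulrC ltr_pdivrMr // [ltRHS]mulrC -ltr_pdivrMr // /D; lra.
have ld : l * `|d| < p.
  rewrite mulrC ltr_pdivrMr // [ltRHS]mulrC -ltr_pdivrMr // /D; lra.
have pos : 0 < p + l * d.
  have : - (l * `|d|) <= l * d by rewrite -mulrN ler_pM2l // lerNl ler_normr lexx orbT.
  by lra.
have hc := @xcoord_tail_convex s t l qs0 qt0; rewrite (ltW l0) l1 in hc.
move/(_ isT): hc; rewrite -/A -/d; set u := s + l * d => hc.
have uw : u - w = p + l * d by rewrite /u /p; ring.
have qu0 : 0 < q u.
  have [d0|d0] := leP 0 d.
    apply: lt_le_trans qt0 (tail_mono dF _).
    by have : l * d <= 1 * d; [rewrite ler_wpM2r|rewrite /u /d; lra].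
  apply: lt_le_trans qs0 (tail_mono dF _).
  by rewrite gerDl mulr_ge0_le0 // ltW.
have wu : w <= u by rewrite -subr_ge0 uw ltW.
have := opt u wu; rewrite uw -/p => hopt.
pose z := (X u - X s) / e.
have zE : X u = X s + e * z by rewrite /z mulrC divfK ?gt_eqF // addrC subrK.
have dz : 0 < 1 + (1 - al) * z.
  have : 0 < 1 + (1 - al) * X u by exact: xcoord_dom.
  rewrite zE (_ : 1 + _ = e * (1 + (1 - al) * z)); last by rewrite /e; ring.
  by rewrite pmulr_rgt0.
have quE : q u = q s * Gammabar al z.
  have := GammabarK al qu0; rewrite zE => <-.
  by rewrite Gammabar_scale // GammabarK.
have hz : (p + l * d) * (1 - z) <= p.
  have : (p + l * d) * Gammabar al z <= p.
    by move: hopt; rewrite quE mulrCA [leRHS]mulrC ler_pM2l.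
  by apply: le_trans; rewrite ler_pM2l // Gammabar_ge.
have ze : z * e <= l * A by rewrite /z divfK ?gt_eqF //; lra.
have h1 : l * d <= (p + l * d) * z by lra.
have h2 : l * d * e <= (p + l * d) * (l * A).
  apply: le_trans (_ : (p + l * d) * (z * e) <= _); last by rewrite ler_pM2l.
  by rewrite mulrA ler_pM2r.
have h3 : d * e <= (p + l * d) * A.
  by rewrite -(ler_pM2l l0); rewrite mulrA (mulrCA l).
have h4 : l * (A * d) <= l * `|A * d| by rewrite ler_pM2l // ler_norm.
rewrite /gap in lA; lra.
Qed.

End RegularCurves.

(** * Optimal prices under a compact argmax *)

Section Responses.
Variables (R : realType) (F f : R -> R).
Hypothesis dF : has_density F f.

Lemma compact_response_interior (w r : R) : compact (responses F w) ->
  responses F w r -> w < r /\ 0 < tail F r.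
Proof.
move=> cpt [wr opt].
suff pos : 0 < (r - w) * tail F r.
  have rw : 0 <= r - w by rewrite subr_ge0.
  move: pos; rewrite le_eqVlt in rw; case/predU1P: rw => [<-|rw].
    by rewrite mul0r ltxx.
  by rewrite pmulr_rgt0 // => ->; rewrite -subr_gt0.
rewrite ltNge; apply/negP => le0.
have zero t : w <= t -> (t - w) * tail F t = 0.
  move=> wt; apply/le_anti; rewrite (le_trans (opt t wt) le0) /=.
  by apply: mulr_ge0; [rewrite subr_ge0|exact: (tail_ge0 dF)].
have [M [_ hM]] := compact_bounded cpt.
(* If the maximal profit is 0, every price above [w] is optimal; this one exceeds both [w] and the
   bound [|M| + 1]. *)
have := hM (`|M| + 1) _ (`|w| + `|M| + 2) _.
have wB : w <= `|w| + `|M| + 2.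
  by apply: le_trans (ler_norm w) _; rewrite -addrA lerDl addr_ge0.
have Mlt : M < `|M| + 1 by apply: le_lt_trans (ler_norm M) _; rewrite ltrDl.
move=> /(_ Mlt); rewrite /responses /= => /(_ _)/wrap[].
  by split=> // t wt; rewrite !zero.
rewrite ger0_norm; last by rewrite !addr_ge0.
have := normr_ge0 w; lra.
Qed.

Lemma edist_set_le (S : set R) (s e : R) : S !=set0 -> compact S ->
  (edist_set s S <= e%:E)%E -> exists2 r, S r & `|s - r| <= e.
Proof.
move=> S0 cS he.
have cont : {within S, continuous (fun r => `|s - r|)}.
  apply: continuous_subspaceT => x; apply: cvg_norm; apply: cvgB => //; exact: cvg_cst.
have [c cS' hc] := compact_EVT_min S0 cS cont.
exists c; first by rewrite inE in cS'.
rewrite -lee_fin; apply: le_trans he.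
apply: le_ereal_inf_tmp => _ [r Sr <-]; rewrite lee_fin.
by apply: hc; rewrite inE.
Qed.

End Responses.

(** * Demand curves of convex inverse price curves *)

Section CurveOfInverseDemand.
Variables (R : realType) (al : R) (b : \bar R) (X : R -> R).
Hypothesis hal : 0 <= al <= 1.
Hypothesis X0 : forall s, (s%:E < b)%E -> 0 <= X s.
Hypothesis subX : forall s, (s%:E < b)%E -> exists d : R,
  [/\ 0 <= d, 0 < X s -> 0 < d &
      forall t, (t%:E < b)%E -> X s + d * (t - s) <= X t].
Hypothesis zeroX : exists2 s, (s%:E < b)%E & X s = 0.
Hypothesis unbX : forall C, exists2 s, (s%:E < b)%E & C <= X s.

(** [b] is the upper end of the support: [+oo] for an envelope of finitely many lines, finite for a
    curve whose demand reaches 0. The values of [X] from [b] on are irrelevant. *)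
Definition curve_cdf (s : R) : R :=
  if (s%:E < b)%E then 1 - Gammabar al (X s) else 1.
Local Notation F := curve_cdf.

Lemma tail_curve (s : R) : (s%:E < b)%E -> tail F s = Gammabar al (X s).
Proof. by rewrite /tail /curve_cdf => ->; rewrite subKr. Qed.

Lemma tail_curve_end (s : R) : (b <= s%:E)%E -> tail F s = 0.
Proof. by rewrite /tail /curve_cdf ltNge => ->; rewrite subrr. Qed.

Let be_ge0 : 0 <= 1 - al. Proof. by rewrite subr_ge0; case/andP: hal. Qed.

Let belowb (s t : R) : s <= t -> (t%:E < b)%E -> (s%:E < b)%E.
Proof. by move=> st; apply: le_lt_trans; rewrite lee_fin. Qed.

Lemma curve_mono (s t : R) : s <= t -> (t%:E < b)%E -> X s <= X t.
Proof.
move=> st tb; have [d [d0 _ h]] := subX (belowb st tb).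
by apply: le_trans (h t tb); rewrite lerDl mulr_ge0 // subr_ge0.
Qed.

Let dom (s : R) : (s%:E < b)%E -> 1 <= 1 + (1 - al) * X s.
Proof. by move=> sb; exact: gp_dom_ge0 (X0 sb). Qed.

Let dom0 (s : R) : (s%:E < b)%E -> 0 < 1 + (1 - al) * X s.
Proof. by move=> sb; exact: lt_le_trans (dom sb). Qed.

Lemma tail_curve_gt0 (s : R) : (0 < tail F s) = (s%:E < b)%E.
Proof.
have [sb|sb] := ltP s%:E b; last by rewrite tail_curve_end // ltxx.
by rewrite tail_curve // Gammabar_gt0 // dom0.
Qed.

Lemma curve_inner (s : R) : 0 < tail F s < 1 -> (s%:E < b)%E /\ 0 < X s.
Proof.
rewrite tail_curve_gt0 => /andP[sb p]; split=> //.
rewrite lt_neqAle X0 // andbT eq_sym; apply/negP => /eqP Xs0.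
by move: p; rewrite tail_curve // Xs0 Gammabar0 ltxx.
Qed.

Section WithSlope.
Variable D : R -> R.
Hypothesis hD : forall s, (s%:E < b)%E ->
  [/\ 0 <= D s, 0 < X s -> 0 < D s &
      forall t, (t%:E < b)%E -> X s + D s * (t - s) <= X t].

Let phi s := Gammabar al (X s) / (1 + (1 - al) * X s).

(** Below [b] this is [phi s * D s], minus the derivative of the tail with a subgradient in place of
    [X']. The slope [D] is monotone only below [b] and may blow up there; [(1 + D)^-1], extended by
    0, is monotone on the whole line and hence measurable, and so is [phi]. *)
Definition curve_density (s : R) : R :=
  (if (s%:E < b)%E then phi s else 0) *
  ((if (s%:E < b)%E then (1 + D s)^-1 else 0) `^ (- 1) - 1).
Local Notation f := curve_density.

Lemma curve_densityE (s : R) : (s%:E < b)%E -> f s = phi s * D s.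
Proof.
move=> sb; have [d0 _ _] := hD sb.
by rewrite /curve_density sb powR_inv1 ?invr_ge0 ?addr_ge0 // invrK [1 + _]addrC addrK.
Qed.

Lemma curve_density_end (s : R) : (b <= s%:E)%E -> f s = 0.
Proof. by rewrite /curve_density leNgt => /negbTE ->; rewrite mul0r. Qed.

Let Dmono (s t : R) : s <= t -> (t%:E < b)%E -> D s <= D t.
Proof.
rewrite le_eqVlt => /predU1P[->//|st tb].
have sb := belowb (ltW st) tb.
have [_ _ hs] := hD sb; have [_ _ ht] := hD tb.
have := hs t tb; have := ht s sb => h1 h2.
have ts0 : 0 < t - s by rewrite subr_gt0.
rewrite -(ler_pM2r ts0).
have -> : D t * (t - s) = - (D t * (s - t)) by ring.
lra.
Qed.

Let phi0 (s : R) : (s%:E < b)%E -> 0 < phi s.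
Proof. by move=> sb; rewrite divr_gt0 ?Gammabar_gt0 ?dom0. Qed.

Let phi_mono (s t : R) : s <= t -> (t%:E < b)%E -> phi t <= phi s.
Proof.
move=> st tb; have sb := belowb st tb.
apply: ler_pM.
- by rewrite ltW // Gammabar_gt0 // dom0.
- by rewrite invr_ge0 ltW // dom0.
- by rewrite Gammabar_mono ?dom0 // curve_mono.
- by rewrite lef_pV2 ?posrE ?dom0 // lerD2l ler_wpM2l // curve_mono.
Qed.

Let phi_le1 (s : R) : (s%:E < b)%E -> phi s <= 1.
Proof.
move=> sb; rewrite ler_pdivrMr ?dom0 // mul1r; apply: le_trans (dom sb).
by rewrite Gammabar_le1 // X0.
Qed.

Let f0 (s : R) : 0 <= f s.
Proof.
have [sb|sb] := ltP s%:E b; last by rewrite curve_density_end.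
by rewrite curve_densityE // mulr_ge0 ?(ltW (phi0 sb)) //; case: (hD sb).
Qed.

Let mf : measurable_fun [set: R] f.
Proof.
apply: measurable_funM.
  apply: nonincreasing_measurable => // s t st.
  case: ifPn => [tb|tb]; first by rewrite (belowb st tb) phi_mono.
  by case: ifPn => // sb; rewrite ltW // phi0.
apply: measurable_funB => //.
apply: (measurableT_comp (measurable_powR _)).
apply: nonincreasing_measurable => // s t st.
case: ifPn => [tb|tb].
  rewrite (belowb st tb) lef_pV2 ?posrE ?lerD2l ?Dmono //.
  - by case: (hD tb) => h _ _; lra.
  - by case: (hD (belowb st tb)) => h _ _; lra.
case: ifPn => // sb; rewrite invr_ge0.
by case: (hD sb) => h _ _; lra.
Qed.

(** Convexity of [Gammabar al]: the coefficient is minus its derivative at [x]. *)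
Lemma Gammabar_chord (x y : R) : 0 <= x -> 0 <= y ->
  Gammabar al x - Gammabar al y <= Gammabar al x / (1 + (1 - al) * x) * (y - x).
Proof.
move=> x0 y0; set e := 1 + _.
have e0 : 0 < e by apply: lt_le_trans (gp_dom_ge0 hal x0).
pose z := (y - x) / e.
have yE : y = x + e * z by rewrite /z mulrC divfK ?gt_eqF // addrC subrK.
have dz : 0 < 1 + (1 - al) * z.
  have : 0 < 1 + (1 - al) * y by apply: lt_le_trans (gp_dom_ge0 hal y0).
  by rewrite yE (_ : 1 + _ = e * (1 + (1 - al) * z)) ?pmulr_rgt0 // /e; ring.
have -> : Gammabar al x / e * (y - x) = Gammabar al x * z by rewrite /z; ring.
rewrite {1}yE Gammabar_scale //.
have := Gammabar_ge hal dz; rewrite -(ler_pM2l (Gammabar_gt0 e0)); lra.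
Qed.

Let mu := @lebesgue_measure R.
Let K t := (\int[mu]_(x in `]-oo, t]) (f x)%:E)%E.

(** The integral of the density obeys the same two bounds. Since the gap between them is of the form
    handled by [le_of_quadratic_increments], the integral and the distribution function must
    agree. *)
Let F_bounds (s t : R) : s <= t -> (t%:E < b)%E ->
  phi t * D s * (t - s) <= F t - F s <= phi s * D t * (t - s).
Proof.
move=> st tb; have sb := belowb st tb.
rewrite /curve_cdf tb sb.
have -> : 1 - Gammabar al (X t) - (1 - Gammabar al (X s)) =
  Gammabar al (X s) - Gammabar al (X t) by ring.
have [_ _ /(_ t tb) hs] := hD sb; have [_ _ /(_ s sb) ht] := hD tb.
apply/andP; split.
- have := Gammabar_chord (X0 tb) (X0 sb); rewrite -/(phi t) => h.
  have h1 : phi t * (D s * (t - s)) <= phi t * (X t - X s).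
    by rewrite ler_pM2l ?phi0 //; lra.
  lra.
- apply: le_trans (Gammabar_chord (X0 sb) (X0 tb)) _.
  by rewrite -/(phi s) -mulrA ler_pM2l ?phi0 //; lra.
Qed.

Let I_bounds (s t : R) : s <= t -> (t%:E < b)%E ->
  ((phi t * D s * (t - s))%:E <= \int[mu]_(x in `]s, t]) (f x)%:E <=
   (phi s * D t * (t - s))%:E)%E.
Proof.
move=> st tb; have sb := belowb st tb.
have Ds : 0 <= D s by case: (hD sb).
apply/andP; split.
- apply: integral_oc_ge => //; first by rewrite mulr_ge0 // ltW // phi0.
  move=> u su ut; have ub := belowb ut tb; rewrite curve_densityE //.
  by apply: ler_pM; rewrite ?(ltW (phi0 _)) ?phi_mono ?Dmono // ltW.
- apply: integral_oc_le => // u su ut.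
  have ub := belowb ut tb; rewrite curve_densityE //.
  have Du : 0 <= D u by case: (hD ub).
  by apply: ler_pM; rewrite ?(ltW (phi0 _)) ?phi_mono ?Dmono // ltW.
Qed.

Let K_low (s0 s : R) : (s0%:E < b)%E -> X s0 = 0 -> s < s0 -> K s = 0%E.
Proof.
move=> s0b Xs0 ss0; rewrite /K; under eq_integral => x.
  rewrite inE /= in_itv /= => xs.
  have xs0 := le_lt_trans xs ss0; have xb := belowb (ltW xs0) s0b.
  have [d0 _ /(_ s0 s0b)] := hD xb; rewrite Xs0 => h.
  have Dx : D x = 0.
    apply/le_anti; rewrite d0 andbT -(@pmulr_lle0 _ (s0 - x)) ?subr_gt0 //.
    have := X0 xb; lra.
  rewrite curve_densityE // Dx mulr0; over.
by rewrite integral0.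
Qed.

Let K_inner (t : R) : (t%:E < b)%E -> K t = (F t)%:E.
Proof.
move=> tb; have [s0 s0b Xs0] := zeroX.
have X_low s : s <= s0 -> F s = 0.
  move=> ss0; have sb := belowb ss0 s0b.
  have Xs : X s = 0 by apply/le_anti; rewrite X0 // -Xs0 curve_mono.
  by rewrite /curve_cdf sb Xs Gammabar0 subrr.
have [ts0|ts0] := ltP t s0; first by rewrite (K_low s0b Xs0) // X_low // ltW.
(* Strictly below the zero [s0], where [K_low] applies; both functions vanish at [a]. *)
pose a := s0 - 1; have as0 : a < s0 by rewrite /a; lra.
have at_ : a <= t by rewrite ltW // (lt_le_trans as0).
have Ka : K a = 0%E by exact: K_low as0.
have Kfin u : a <= u -> u <= t -> K u \is a fin_num.
  move=> au ut; rewrite /K (integral_Nyc_split mf f0 au) -/(K a) Ka add0e.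
  have /andP[h1 h2] := I_bounds au (belowb ut tb).
  by rewrite fin_numElt (lt_le_trans _ h1) ?ltNyr // (le_lt_trans h2) ?ltry.
pose k u := fine (K u).
have kE u v : a <= u -> u <= v -> v <= t ->
    phi v * D u * (v - u) <= k v - k u <= phi u * D v * (v - u).
  move=> au uv vt; have vb := belowb vt tb.
  have av := le_trans au uv; have ut := le_trans uv vt.
  rewrite -!lee_fin EFinB /k !fineK ?Kfin //.
  rewrite {1 3}/K (integral_Nyc_split mf f0 uv) -/(K u).
  rewrite addeC addeA (addeC (- _)%E) subee ?Kfin // add0e.
  exact: I_bounds.
(* The gap splits into a variation of [phi] times [D v <= D t] and a variation of [D] times
   [phi v <= 1], which gives the function [D - D t * phi]. *)
have V u v : a <= u -> u <= v -> v <= t ->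
    phi u * D v * (v - u) - phi v * D u * (v - u) <=
    (v - u) * ((D v - D t * phi v) - (D u - D t * phi u)).
  move=> au uv vt; have vb := belowb vt tb; have ub := belowb uv vb.
  have -> : phi u * D v * (v - u) - phi v * D u * (v - u) =
    (v - u) * ((phi u - phi v) * D v + phi v * (D v - D u)) by ring.
  apply: ler_wpM2l; first by rewrite subr_ge0.
  have h1 : (phi u - phi v) * D v <= (phi u - phi v) * D t.
    by apply: ler_wpM2l; rewrite ?subr_ge0 ?phi_mono ?Dmono.
  have h2 : phi v * (D v - D u) <= 1 * (D v - D u).
    by apply: ler_wpM2r; rewrite ?subr_ge0 ?phi_le1 ?Dmono.
  lra.
have h1 : F t - k t <= F a - k a.
  apply: (@le_of_quadratic_increments _ (fun u => F u - k u)
    (fun u => D u - D t * phi u)) => // u v au uv vt.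
  have /andP[_ hF] := F_bounds uv (belowb vt tb).
  have /andP[hk _] := kE u v au uv vt; have := V u v au uv vt; lra.
have h2 : k t - F t <= k a - F a.
  apply: (@le_of_quadratic_increments _ (fun u => k u - F u)
    (fun u => D u - D t * phi u)) => // u v au uv vt.
  have /andP[hF _] := F_bounds uv (belowb vt tb).
  have /andP[_ hk] := kE u v au uv vt; have := V u v au uv vt; lra.
have ka : k a = 0 by rewrite /k Ka.
have Fa : F a = 0 by rewrite X_low // ltW.
rewrite -[K t]fineK ?Kfin //; congr EFin; rewrite -/(k t).
by apply/le_anti/andP; split; lra.
Qed.

Let mfE (A : set R) : measurable_fun A (fun x => (f x)%:E).
Proof.
apply: (@measurable_funS _ _ _ _ setT) => //; exact/measurable_EFinP.
Qed.

Let total (A : set R) : measurable A -> (forall s, (s%:E < b)%E -> A s) ->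
  (\int[mu]_(x in A) (f x)%:E = 1)%E.
Proof.
move=> mA hA; apply/le_anti/andP; split; last first.
  apply/lee_addgt0Pr => e e0.
  have [C _ hC] := Gammabar_small hal e0; have [t tb Ct] := unbX C.
  have : (K t <= \int[mu]_(x in A) (f x)%:E)%E.
    apply: ge0_subset_integral => //.
    - exact: mfE.
    - by move=> x _; rewrite lee_fin.
    - by move=> x; rewrite /= in_itv /= => xt; exact/hA/(belowb xt).
  rewrite K_inner // => h; apply: le_trans (leeD2r _ h).
  rewrite -EFinD lee_fin /curve_cdf tb; have := hC _ Ct; lra.
(* Sublevel sets of the monotone [X] are intervals that exhaust the prices below [b], whether [b] is
   finite or not; monotone convergence then bounds the total mass by 1. *)
pose S (n : nat) := [set s : R | (s%:E < b)%E /\ X s <= n%:R].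
have mS n : measurable (S n).
  apply: is_interval_measurable => x y [xb xn] [yb yn] z /andP[xz zy].
  split; first exact: belowb zy yb.
  exact: le_trans (curve_mono zy yb) yn.
have Scup : \bigcup_n S n = [set s : R | (s%:E < b)%E].
  apply/seteqP; split => [s [n _ []//]|s sb].
  exists (Num.truncn (X s)).+1 => //; split=> //.
  exact: ltW (truncnS_gt _).
have -> : (\int[mu]_(x in A) (f x)%:E = \int[mu]_(x in \bigcup_n S n) (f x)%:E)%E.
  rewrite integral_mkcond [RHS]integral_mkcond Scup; apply: eq_integral => x _.
  rewrite /patch; have [xb|xb] := ltP x%:E b.
    by rewrite !mem_set //; exact: hA.
  rewrite curve_density_end // [in RHS]memNset; first by case: ifP.
  by rewrite /= ltNge xb.
have cv : (fun n => \int[mu]_(x in S n) (f x)%:E)%E @ \oo -->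
    (\int[mu]_(x in \bigcup_n S n) (f x)%:E)%E.
  apply: ge0_nondecreasing_set_cvg_integral => //.
  - move=> m n mn; apply/subsetPset => s [sb sm]; split=> //.
    by apply: le_trans sm _; rewrite ler_nat.
  - by move=> n; exact: mfE.
  - by move=> n x _; rewrite lee_fin.
rewrite -(cvg_lim _ cv) //; apply: lime_le; first by apply/cvg_ex; eexists; exact: cv.
near=> n; have [t tb nt] := unbX (n%:R + 1).
apply: (@le_trans _ _ (K t)); last first.
  rewrite K_inner // lee_fin /curve_cdf tb gerBl ltW // Gammabar_gt0 // dom0 //.
apply: ge0_subset_integral => //.
- exact: mS.
- exact: mfE.
- by move=> x _; rewrite lee_fin.
- move=> x [xb xn]; rewrite /= in_itv /= leNgt; apply/negP => tx.
  have := curve_mono (ltW tx) xb; lra.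
Unshelve. all: by end_near.
Qed.

Lemma curve_has_density : has_density F f.
Proof.
split=> //; first exact: total.
move=> s; have [sb|sb] := ltP s%:E b; first by rewrite -K_inner.
rewrite total //.
  by rewrite /curve_cdf ltNge sb.
by move=> t tb; rewrite /= in_itv /= -lee_fin ltW // (lt_le_trans tb).
Qed.

Lemma curve_density_gt0 (s : R) : 0 < tail F s < 1 -> 0 < f s.
Proof.
move=> /curve_inner[sb Xs]; rewrite curve_densityE // mulr_gt0 ?phi0 //.
by case: (hD sb) => _ /(_ Xs).
Qed.

(** The ratio of tail to density is [(1 + (1 - al) * X) / D]. Dividing the subgradient inequality at
    [t], evaluated at [s], by [D t] and using [D s <= D t] bounds its growth by
    [(1 - al) * (t - s)]. *)
Lemma curve_density_regular (s t : R) : 0 < tail F s < 1 ->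
  0 < tail F t < 1 -> s <= t ->
  (1 - al) * s - tail F s / f s <= (1 - al) * t - tail F t / f t.
Proof.
move=> /curve_inner[sb Xs] /curve_inner[tb Xt] st.
have [_ /(_ Xs) Ds0 _] := hD sb; have [_ /(_ Xt) Dt0 /(_ s sb) ht] := hD tb.
have E u : (u%:E < b)%E -> 0 < D u ->
    tail F u / f u = (1 + (1 - al) * X u) / D u.
  move=> ub Du; rewrite tail_curve // curve_densityE // /phi.
  by field; rewrite !gt_eqF ?dom0 ?Gammabar_gt0 ?dom0.
rewrite !E //.
have h1 : X t / D t <= X s / D t + (t - s).
  have -> : X s / D t + (t - s) = (X s + (t - s) * D t) / D t.
    by field; rewrite gt_eqF.
  by rewrite ler_pM2r ?invr_gt0 //; lra.
have h2 : (1 + (1 - al) * X s) / D t <= (1 + (1 - al) * X s) / D s.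
  by rewrite ler_pM2l ?dom0 // lef_pV2 ?posrE // Dmono.
have h3 := ler_wpM2l be_ge0 h1.
have -> : (1 + (1 - al) * X t) / D t = (D t)^-1 + (1 - al) * (X t / D t) by ring.
have h4 : (1 + (1 - al) * X s) / D t = (D t)^-1 + (1 - al) * (X s / D t) by ring.
lra.
Qed.

End WithSlope.

Lemma curve_regular : alpha_regular al F.
Proof.
have [D hD] : {D : R -> R & forall s, (s%:E < b)%E ->
  [/\ 0 <= D s, 0 < X s -> 0 < D s &
      forall t, (t%:E < b)%E -> X s + D s * (t - s) <= X t]}.
  apply: (@choice _ _ (fun s d => (s%:E < b)%E -> [/\ 0 <= d, 0 < X s -> 0 < d &
      forall t, (t%:E < b)%E -> X s + d * (t - s) <= X t])) => s.
  have [sb|sb] := ltP s%:E b; last by exists 0.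
  by have [d hd] := subX sb; exists d.
exists (curve_density D); split.
- exact: curve_has_density.
- exact: curve_density_gt0.
- exact: curve_density_regular.
Qed.

(** * Optimality and compactness from a supporting line *)

Section Optimality.
Variables (w r m : R).
Hypotheses (rb : (r%:E < b)%E) (m0 : 0 < m).
Hypothesis rE : r = w + (1 + (1 - al) * X r) * m.

Let e := 1 + (1 - al) * X r.
Let e0 : 0 < e. Proof. exact: dom0. Qed.
Let rwE : r - w = e * m. Proof. by rewrite {1}rE /e; ring. Qed.
Let rw0 : 0 < r - w. Proof. by rewrite rwE mulr_gt0. Qed.

(** On the generalized-Pareto curve given by the supporting line, the profit at [t] is the profit at
    [r] times [(1 + z) * Gammabar al z], which is at most 1 by [Gammabar_le]. *)
Lemma curve_profit_gp (t : R) : w < t ->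
  0 < 1 + (1 - al) * (X r + (t - r) / m) /\
  (t - w) * Gammabar al (X r + (t - r) / m) <= (r - w) * Gammabar al (X r).
Proof.
move=> wt; pose z := (t - r) / (r - w).
have zE : X r + (t - r) / m = X r + e * z.
  by rewrite /z rwE; field; rewrite !gt_eqF.
have z1 : 0 < 1 + z.
  have -> : 1 + z = (t - w) / (r - w) by rewrite /z; field; rewrite gt_eqF.
  by rewrite divr_gt0 // subr_gt0.
have dz : 0 < 1 + (1 - al) * z.
  (* A convex combination of 1 and [1 + z], both positive. *)
  have -> : 1 + (1 - al) * z = al + (1 - al) * (1 + z) by ring.
  have /andP[al0 al1] := hal.
  move: be_ge0; rewrite le_eqVlt => /predU1P[h|h].
    have : al = 1 by lra.
    by move=> ->; rewrite subrr mul0r addr0.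
  by apply: ltr_wpDl => //; exact: mulr_gt0.
have dE : 1 + (1 - al) * (X r + e * z) = e * (1 + (1 - al) * z).
  by rewrite /e; ring.
rewrite zE dE mulr_gt0 //; split=> //.
rewrite Gammabar_scale //.
have -> : (t - w) * (Gammabar al (X r) * Gammabar al z) =
    (r - w) * Gammabar al (X r) * ((1 + z) * Gammabar al z).
  by rewrite /z; field; rewrite gt_eqF.
rewrite -[leRHS]mulr1 ler_pM2l ?Gammabar_le //.
by rewrite mulr_gt0 // Gammabar_gt0.
Qed.

Lemma curve_response : (forall t, (t%:E < b)%E -> X r + (t - r) / m <= X t) ->
  responses F w r.
Proof.
move=> sup; split; first by rewrite ltW // -subr_gt0.
have q0 : 0 < tail F r by rewrite tail_curve_gt0.
move=> t; rewrite le_eqVlt => /predU1P[<-|wt].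
  by rewrite subrr mul0r mulr_ge0 // ltW.
have [tb|tb] := ltP t%:E b; last first.
  by rewrite tail_curve_end // mulr0 mulr_ge0 // ltW.
have [d h] := curve_profit_gp wt; rewrite !tail_curve //.
by apply: le_trans h; rewrite ler_pM2l ?subr_gt0 // Gammabar_mono // sup.
Qed.

(** A support alone does not bound the argmax: for [al = 0] the factor [(1 + z) * Gammabar al z] is
    identically 1, so profit is constant as long as [X] follows the line. Leaving the line strictly
    after [B] makes profit strictly smaller. *)
Lemma curve_responses_bounded (B t : R) : responses F w t ->
  (forall u, B < u -> (u%:E < b)%E -> X r + (u - r) / m < X u) ->
  w <= t <= Num.max B r.
Proof.
move=> [wt opt] strict; rewrite wt leNgt; apply/negP; rewrite gt_max => /andP[Bt rt].
have wr : w < r by rewrite -subr_gt0.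
have := opt r (ltW wr); apply/negP; rewrite -ltNge.
have [tb|tb] := ltP t%:E b; last first.
  by rewrite tail_curve_end // mulr0 mulr_gt0 // tail_curve_gt0.
have wt' := lt_trans wr rt.
have [d h] := curve_profit_gp wt'; rewrite !tail_curve //.
by apply: lt_le_trans h; rewrite ltr_pM2l ?subr_gt0 // Gammabar_lt // strict.
Qed.

Lemma curve_responses_compact (B : R) :
  (forall u, B < u -> (u%:E < b)%E -> X r + (u - r) / m < X u) ->
  compact (responses F w).
Proof.
move=> strict; have [f [dF _ _]] := curve_regular.
apply: (@subclosed_compact _ _ `[w, Num.max B r]); last 2 first.
- exact: segment_compact.
- by move=> t /curve_responses_bounded /(_ strict); rewrite /= in_itv.
have -> : responses F w = [set s | w <= s] `&` \bigcap_(t in [set t | w <= t])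
    [set s | (t - w) * tail F t <= (s - w) * tail F s].
  by apply/seteqP; split => s [ws h]; split.
apply: closedI; first exact: closed_ge.
apply: closed_bigI => t _.
pose g s := (s - w) * tail F s.
suff : closed (g @^-1` [set y | (t - w) * tail F t <= y]) by [].
apply: closed_comp; last exact: closed_ge.
move=> x _; apply: cvgM; last exact: (tail_continuous dF).
by apply: cvgB => //; exact: cvg_cst.
Qed.

End Optimality.

End CurveOfInverseDemand.

(** * Maxima of lines *)

Section MaxOfLines.
Variable R : realType.
Implicit Types (u v : R * R) (l : seq (R * R)) (s c x : R).

Definition line u s := u.1 + u.2 * s.

(** Lines give [x] as a function of the price, so the lower envelope of the supporting lines of the
    price curve becomes a maximum. The final 0 caps demand at 1. *)
Definition maxl l s := foldr (fun u x => Num.max (line u s) x) 0 l.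

Lemma maxl_ge0 l s : 0 <= maxl l s.
Proof. by elim: l => //= u l IH; rewrite le_max IH orbT. Qed.

Lemma line_le_maxl l s u : u \in l -> line u s <= maxl l s.
Proof.
elim: l => //= v l IH; rewrite inE le_max => /predU1P[->|/IH ->].
  by rewrite lexx.
by rewrite orbT.
Qed.

Lemma maxl_attained l s : maxl l s = 0 \/ exists2 u, u \in l & maxl l s = line u s.
Proof.
elim: l => [|u l IH] /=; first by left.
case: leP => h; last by right; exists u; rewrite ?mem_head.
by case: IH => [->|[v vl ->]]; [left|right; exists v => //; rewrite inE vl orbT].
Qed.

Lemma maxl_le l s x : 0 <= x -> (forall u, u \in l -> line u s <= x) ->
  maxl l s <= x.
Proof.
by move=> x0 h; case: (maxl_attained l s) => [->//|[u ul ->]]; exact: h.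
Qed.

Lemma maxl_unique l s x : 0 <= x -> (forall u, u \in l -> line u s <= x) ->
  (x = 0 \/ exists2 u, u \in l & x = line u s) -> maxl l s = x.
Proof.
move=> x0 h hx; apply/le_anti; rewrite maxl_le //=.
by case: hx => [->|[u ul ->]]; [exact: maxl_ge0|exact: line_le_maxl].
Qed.

Lemma maxl_eq_mem l1 l2 s : l1 =i l2 -> maxl l1 s = maxl l2 s.
Proof.
move=> h; apply: maxl_unique; first exact: maxl_ge0.
- by move=> u; rewrite h; exact: line_le_maxl.
- case: (maxl_attained l2 s) => [->|[u ul ->]]; [by left|right].
  by exists u => //; rewrite h.
Qed.

(** A line overtakes each strictly flatter one at a single price; the first two cases come from
    parallel lines and from the empty list. So the steepest line of an envelope governs a
    half-line. *)
Lemma line_dominates_from u l : (forall v, v \in l -> v.2 <= u.2) ->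
  let P s := forall v, v \in l -> line v s <= line u s in
  [\/ forall s, ~ P s, forall s, P s | exists c, forall s, P s <-> c <= s].
Proof.
elim: l => [|v l IH] hu /=; first by constructor 2.
have {IH} := IH (fun w wl => hu w (@mem_behead _ (v :: l) w wl)).
pose P s := forall w, w \in l -> line w s <= line u s.
pose Q s := forall w, w \in v :: l -> line w s <= line u s.
rewrite /= -/P -/Q => IH.
have QE s : Q s <-> line v s <= line u s /\ P s.
  split=> [h|[h1 h2] w].
    by split=> [|w wl]; apply: h; rewrite inE ?eqxx // wl orbT.
  by rewrite inE => /predU1P[->//|/h2].
have := hu v (mem_head _ _); rewrite le_eqVlt => /predU1P[vu|vu].
- have E s : (line v s <= line u s) = (v.1 <= u.1) by rewrite /line vu lerD2r.
  have [h|h] := leP v.1 u.1.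
    have QP s : Q s <-> P s by rewrite QE E h; split=> [[]|].
    case: IH => [IH|IH|[c IH]].
    + by constructor 1 => s /QP/IH.
    + by constructor 2 => s; apply/QP/IH.
    + by constructor 3; exists c => s; apply: iff_trans (QP s) (IH s).
  by constructor 1 => s /QE; rewrite E leNgt h => -[].
- pose c' := (v.1 - u.1) / (u.2 - v.2).
  have E s : (line v s <= line u s) = (c' <= s).
    rewrite /c' ler_pdivrMr ?subr_gt0 // /line; apply/idP/idP; lra.
  case: IH => [IH|IH|[c IH]].
  + by constructor 1 => s /QE[_ /IH].
  + constructor 3; exists c' => s; split=> [/QE[]|h]; first by rewrite E.
    by apply/QE; rewrite E; split=> //; exact: IH.
  + constructor 3; exists (Num.max c' c) => s; rewrite ge_max -E.
    split=> [/QE[-> /IH]//|/andP[h1 h2]].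
    by apply/QE; split=> //; apply/IH.
Qed.

End MaxOfLines.

(** * Envelopes of lines are piecewise generalized Pareto *)

Section PiecewiseCurves.
Variables (R : realType) (al : R).
Hypothesis hal : 0 <= al <= 1.

Lemma Gbar_line (u : R * R) : 0 < u.2 -> exists2 g : GP_piece R, valid_GP g &
  forall s, Gbar al g s = Gammabar al (Num.max 0 (line u s)).
Proof.
move=> u0; have G1 : 0 < Gammabar al 1.
  by apply/Gammabar_gt0/(lt_le_trans _ (gp_dom_ge0 hal _)).
(* The endpoints are the prices where the line takes the values 0 and 1. With [qa = 1] the cut-off
   of [Gbar] is the left endpoint. *)
exists (GPPiece (- u.1 / u.2) 1 ((1 - u.1) / u.2) (Gammabar al 1)).
  split=> /=; last by rewrite G1 Gammabar_lt1.
  by rewrite ltr_pM2r ?invr_gt0 // ltrDr.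
move=> s; rewrite /Gbar divr1 xcoord1 mul0r mulr0 addr0 divr1 mul1r.
rewrite xcoordK; last exact: lt_le_trans (gp_dom_ge0 hal _).
have E : 1 * ((s - - u.1 / u.2) / ((1 - u.1) / u.2 - - u.1 / u.2)) = line u s.
  by rewrite /line; field; rewrite gt_eqF //; apply/eqP; lra.
rewrite E; case: ifPn => h.
- rewrite max_l ?Gammabar0 // /line.
  by move: h; rewrite ltr_pdivlMr //; lra.
- rewrite max_r // /line.
  by move: h; rewrite -leNgt ler_pdivrMr //; lra.
Qed.

Lemma piecewise_Gbar_glue (D : set R) (A B : R -> R) (c : R) (g : GP_piece R) :
  piecewise_Gbar_on al D A -> valid_GP g ->
  (forall s, D s -> s < c -> B s = A s) ->
  (forall s, D s -> c <= s -> B s = Gbar al g s) ->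
  piecewise_Gbar_on al D B.
Proof.
move=> [n [t [gs [tn vg hA]]]] vg' hlt hge.
have tmono k j : (1 <= k)%N -> (k <= j)%N -> (j <= n)%N -> t k <= t j.
  move=> k1; elim: j => [|j IH]; first by rewrite leqn0 => /eqP k0; rewrite k0 in k1.
  rewrite leq_eqVlt ltnS => /predU1P[->//|kj] jn.
  apply: le_trans (IH kj (ltnW jn)) (ltW (tn j _)).
  by rewrite (leq_trans k1 kj).
(* [N] is the index of the last breakpoint before [c], or 0 if there is none; pieces after the
   [N]-th are replaced by [g]. *)
have [N [Nn Nlo Nhi]] : exists N, [/\ (N <= n)%N, (1 <= N)%N -> t N < c &
    (N < n)%N -> c <= t N.+1].
  elim: (n) => [|m [N [Nm Nlo Nhi]]]; first by exists 0.
  have [h|h] := ltP (t m.+1) c; first by exists m.+1; rewrite ltnn.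
  exists N; split=> //; first exact: leqW.
  move=> _; move: Nm; rewrite leq_eqVlt => /predU1P[->//|]; exact: Nhi.
exists N.+1, (fun k => if (k <= N)%N then t k else c),
  (fun k => if (k <= N)%N then gs k else g); split.
- move=> k /andP[k1 kN1]; have [kN|Nk] := ltnP k N.
    by rewrite (ltnW kN) tn // k1 (leq_trans kN).
  have kN : k = N by apply/eqP; rewrite eqn_leq Nk -ltnS kN1.
  by rewrite kN leqnn; apply: Nlo; rewrite -kN.
- by move=> k _; case: ifP => // kN; exact/vg/(leq_trans kN).
move=> k s kN1 Ds; case: ifPn => [kN|kN] lo hi; last first.
  apply: hge => //; apply: lo; apply: leq_trans (_ : N.+1 <= _)%N => //.
  by rewrite ltnNge.
rewrite ltnS kN in hi.
have sc : s < c.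
  move: (hi isT); case: ifPn => // kN' h; apply: lt_trans (Nlo _).
    by apply: lt_le_trans h (tmono _ _ _ _ _).
  exact: leq_trans kN'.
rewrite hlt //; apply: hA => //; first exact: leq_trans Nn.
move=> kn; move: (hi isT); case: ifPn => // kN' _.
have kE : k = N by apply/eqP; rewrite eqn_leq kN leqNgt.
by rewrite kE in kn *; exact: lt_le_trans sc (Nhi kn).
Qed.

(** With the lines sorted by decreasing slope, the head takes over from the envelope of the others
    at one price at most, so each induction step appends one piece. *)
Lemma piecewise_Gbar_maxl (l : seq (R * R)) (D : set R) (A : R -> R) :
  l != [::] -> (forall u, u \in l -> 0 < u.2) ->
  (forall s, D s -> A s = Gammabar al (maxl l s)) -> piecewise_Gbar_on al D A.
Proof.
pose steeper (u v : R * R) := v.2 <= u.2.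
wlog sl : l / sorted steeper l => [hw l0 lpos hA|].
  apply: (hw (sort steeper l)).
  - by apply: sort_sorted => u v; exact: le_total.
  - by rewrite -size_eq0 size_sort size_eq0.
  - by move=> u; rewrite mem_sort; exact: lpos.
  - by move=> s Ds; rewrite hA //; congr Gammabar; apply: maxl_eq_mem => u; rewrite mem_sort.
elim: l sl A => // u l IH ul A _ lpos hA.
have u0 := lpos u (mem_head _ _).
have [g vg gE] := Gbar_line u0.
have hu v : v \in l -> v.2 <= u.2.
  have tr : transitive steeper by move=> y x z; rewrite /steeper => h1 h2; exact: le_trans h2 h1.
  by move: v; apply/allP; exact: order_path_min tr ul.
have topE s : (forall v, v \in l -> line v s <= line u s) ->
    maxl (u :: l) s = Num.max 0 (line u s).
  move=> h; apply: maxl_unique; first by rewrite le_max lexx.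
  - by move=> v; rewrite inE => /predU1P[->|/h hv]; rewrite le_max ?lexx ?hv orbT.
  - by case: leP => _; [right; exists u; rewrite ?mem_head|left].
have single : (forall s v, v \in l -> line v s <= line u s) -> piecewise_Gbar_on al D A.
  move=> h; exists 0, (fun=> 0), (fun=> g); split=> //.
    by move=> k; rewrite ltn0 andbF.
  by move=> k s _ Ds _ _; rewrite hA // gE topE //; exact: h.
have [l0|l0] := eqVneq l [::]; first by apply: single => s v; rewrite l0.
have pw := IH (path_sorted ul) (fun s => Gammabar al (maxl l s)) l0
  (fun v vl => lpos v (@mem_behead _ (u :: l) v vl)) (fun s _ => erefl).
have botE s : ~ (forall v, v \in l -> line v s <= line u s) ->
    maxl (u :: l) s = maxl l s.
  move=> /existsNP[v /not_implyP[vl /negP]]; rewrite -ltNge => h /=.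
  by apply/max_r/(le_trans (ltW h))/line_le_maxl.
case: (line_dominates_from hu) => [no|all|[c hc]].
- case: pw => n [t [gs [h1 h2 h3]]]; exists n, t, gs; split=> // k s kn Ds lo hi.
  by rewrite hA // botE -?h3.
- by apply: single => s; exact: all.
- apply: (piecewise_Gbar_glue pw vg (c := c)) => s Ds sc.
  + by rewrite hA // botE // => /hc; rewrite leNgt sc.
  + by rewrite hA // gE topE //; exact/hc.
Qed.

End PiecewiseCurves.

(** * Supporting slopes of configurations *)

Section ConcavePoints.
Variables (R : realType) (s : seq (R * R)).
Local Notation pt i := (nth (0, 0) s i).
Local Notation n := (size s).
Hypothesis hlt : forall i j, (i < j)%N -> (j < n)%N -> (pt i).1 < (pt j).1.

(** Indices start at 0 here: [C i] is [secant s i.+1], and point [i] lies between [secant s i] on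
    its left and [secant s i.+1] on its right. *)
Let C i := ((pt i.+1).2 - (pt i).2) / ((pt i.+1).1 - (pt i).1).

Lemma secantS (i : nat) : (i.+1 < n)%N -> secant s i.+1 = (C i)%:E.
Proof. by move=> h; rewrite /secant /= leqNgt h. Qed.

Lemma secant_last (i : nat) : (n <= i.+1)%N -> secant s i.+1 = 0%E.
Proof. by move=> h; rewrite /secant /= h. Qed.

Let gap0 i : (i.+1 < n)%N -> 0 < (pt i.+1).1 - (pt i).1.
Proof. by move=> h; rewrite subr_gt0 hlt. Qed.

Let ptS i : (i.+1 < n)%N ->
  (pt i.+1).2 = (pt i).2 + C i * ((pt i.+1).1 - (pt i).1).
Proof. by move=> h; rewrite divfK ?gt_eqF ?gap0 // addrC subrK. Qed.

Section Supports.
Hypothesis hcon : forall j, (1 <= j)%N -> (j.+1 < n)%N ->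
  (secant s j.+1 <= secant s j)%E.

Let Cmono i j : (i <= j)%N -> (j.+1 < n)%N -> C j <= C i.
Proof.
elim: j => [|j IH]; first by rewrite leqn0 => /eqP->.
rewrite leq_eqVlt ltnS => /predU1P[->//|ij] jn.
apply: le_trans (IH ij (ltnW jn)).
by rewrite -lee_fin -!secantS ?hcon //; exact: ltnW.
Qed.

Lemma support_right (i k : nat) (mu : R) : ((i.+1 < n)%N -> C i <= mu) ->
  (i <= k)%N -> (k < n)%N -> (pt k).2 <= (pt i).2 + mu * ((pt k).1 - (pt i).1).
Proof.
move=> hmu; elim: k => [|k IH].
  by rewrite leqn0 => /eqP-> _; rewrite subrr mulr0 addr0.
rewrite leq_eqVlt ltnS => /predU1P[->|ik] kn; first by rewrite subrr mulr0 addr0.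
have h := IH ik (ltnW kn); rewrite ptS //.
have : C k * ((pt k.+1).1 - (pt k).1) <= mu * ((pt k.+1).1 - (pt k).1).
  rewrite ler_pM2r ?gap0 //; apply: le_trans (Cmono ik kn) (hmu _).
  exact: leq_ltn_trans kn.
lra.
Qed.

Lemma support_left (i d : nat) (mu : R) : ((0 < i)%N -> mu <= C i.-1) ->
  (i < n)%N -> (pt (i - d)).2 <= (pt i).2 + mu * ((pt (i - d)).1 - (pt i).1).
Proof.
move=> hmu hi; elim: d => [|d IH]; first by rewrite subn0 subrr mulr0 addr0.
(* Subtraction is truncated: once [d >= i], both indices are 0. *)
have [di|id] := ltnP d i; last first.
  by rewrite (_ : i - d.+1 = i - d)%N //; lia.
pose k := (i - d.+1)%N; have kE : (i - d = k.+1)%N by rewrite /k; lia.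
rewrite -/k; rewrite kE in IH.
have kn : (k.+1 < n)%N by rewrite -kE; lia.
have := ptS kn.
have : mu * ((pt k.+1).1 - (pt k).1) <= C k * ((pt k.+1).1 - (pt k).1).
  rewrite ler_pM2r ?gap0 //; apply: le_trans (hmu _) (Cmono _ _); rewrite /k; lia.
lra.
Qed.

Lemma support_point (i k : nat) (mu : R) : ((i.+1 < n)%N -> C i <= mu) ->
  ((0 < i)%N -> mu <= C i.-1) -> (i < n)%N -> (k < n)%N ->
  (pt k).2 <= (pt i).2 + mu * ((pt k).1 - (pt i).1).
Proof.
move=> h1 h2 hi hk; have [ik|ki] := leqP i k; first exact: support_right.
by have := @support_left i (i - k) mu h2 hi; rewrite subKn // ltnW.
Qed.

Lemma support_of_secants (i k : nat) (mu : R) : (i < n)%N -> (k < n)%N ->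
  (secant s i.+1 <= mu%:E <= secant s i)%E ->
  (pt k).2 <= (pt i).2 + mu * ((pt k).1 - (pt i).1).
Proof.
move=> hi hk /andP[h1 h2]; apply: support_point => // h.
- by rewrite secantS // lee_fin in h1.
- by move: h2; rewrite -{1}(prednK h) secantS ?lee_fin // prednK.
Qed.

(** Supplies slopes at the nodes where none is prescribed. The last secant is the smallest one, so
    its positivity passes to all of them. *)
Lemma support_exists (i : nat) : (0 < secant s n.-1)%E -> (i < n)%N ->
  exists2 mu : R, 0 < mu & forall k, (k < n)%N ->
    (pt k).2 <= (pt i).2 + mu * ((pt k).1 - (pt i).1).
Proof.
move=> h0 hi.
have Cpos j : (j.+1 < n)%N -> 0 < C j.
  move=> jn; have nE : n.-1 = n.-2.+1 by lia.
  have n2 : (n.-2.+1 < n)%N by lia.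
  move: h0; rewrite nE secantS // lte_fin => /lt_le_trans; apply.
  by apply: Cmono => //; lia.
have [i1|ni] := ltnP i.+1 n.
  exists (C i); first exact: Cpos.
  move=> k hk; apply: support_point => // i0.
  by apply: Cmono; rewrite ?prednK //; lia.
(* At the last point the left secant serves; a single point admits any positive slope. *)
case: i => [|i] in hi ni *.
  by exists 1 => // k hk; apply: support_point => //; rewrite ltnNge ni.
exists (C i); first exact: Cpos.
by move=> k hk; apply: support_point => //; rewrite ltnNge ni.
Qed.

End Supports.

Section Secants.
Variable sg : nat -> R.
Hypothesis sg0 : forall i, (i < n)%N -> 0 < sg i.
Hypothesis hsg : forall i k, (i < n)%N -> (k < n)%N ->
  (pt k).2 <= (pt i).2 + sg i * ((pt k).1 - (pt i).1).

Lemma secant_le_slope (i : nat) (mu : R) : (i < n)%N -> 0 < mu ->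
  (forall k, (k < n)%N -> (pt k).2 <= (pt i).2 + mu * ((pt k).1 - (pt i).1)) ->
  (secant s i.+1 <= mu%:E <= secant s i)%E.
Proof.
move=> hi mu0 h; apply/andP; split.
- have [i1|ni] := ltnP i.+1 n; last by rewrite secant_last // lee_fin ltW.
  rewrite secantS // lee_fin ler_pdivrMr ?gap0 //.
  by have := h _ i1; lra.
- case: i => [|i] in hi h *; first by rewrite /secant /= leey.
  rewrite secantS // lee_fin ler_pdivlMr ?gap0 //.
  by have := h _ (ltnW hi); lra.
Qed.

Lemma secants_nonincreasing (j : nat) : (1 <= j)%N -> (j.+1 < n)%N ->
  (secant s j.+1 <= secant s j)%E.
Proof.
move=> j1 jn; have hj := ltnW jn.
have /andP[h1 h2] := @secant_le_slope j (sg j) hj (sg0 hj) (fun k => hsg hj).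
exact: le_trans h1 h2.
Qed.

Lemma last_secant_gt0 : (0 < n)%N -> (0 < secant s n.-1)%E.
Proof.
move=> n0; have hj : (n.-1 < n)%N by rewrite prednK.
have /andP[_ h2] := @secant_le_slope n.-1 (sg n.-1) hj (sg0 hj) (fun k => hsg hj).
by apply: lt_le_trans h2; rewrite lte_fin sg0.
Qed.

End Secants.

End ConcavePoints.

(** * Feasibility without sorting or merging *)

Section SupportedConfigurations.
Variables (R : realType) (T : nat) (al : R) (H : history R T).
Variable p : config R T.
Local Notation nd := (node al H p).

(** Indexing the supports by labels avoids the order of the nodes. Consistency of coinciding nodes
    is implied: at equal first coordinates the two inequalities force equal prices. *)
Definition supported (sg : label T -> R) : Prop :=
  (forall a, 0 < sg a) /\
  forall a b, (nd b).2 <= (nd a).2 + sg a * ((nd b).1 - (nd a).1).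

Definition prescribed (sg : label T -> R) : Prop :=
  (forall i, sg (inl (inr i)) = lat_m p i) /\ sg (inr false) = cur_m p.

Local Notation s := (merged_nodes al H p).

Lemma mem_merged_nodes (u : R * R) : u \in s -> exists a, u = nd a.
Proof. by rewrite mem_sort mem_undup => /mapP[a _ ->]; exists a. Qed.

Lemma node_index (a : label T) : exists2 i, (i < size s)%N & nth (0, 0) s i = nd a.
Proof.
have h : nd a \in s by rewrite mem_sort mem_undup; apply/mapP; exists a; rewrite ?mem_enum.
by exists (index (nd a) s); rewrite ?index_mem ?nth_index.
Qed.

Lemma nth_merged_nodes (i : nat) : (i < size s)%N ->
  exists a, nth (0, 0) s i = nd a.
Proof. by move=> hi; apply/mem_merged_nodes/mem_nth. Qed.

Lemma merged_nodes_gt0 : (0 < size s)%N.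
Proof. by have [i hi _] := node_index (inr true); exact: leq_ltn_trans hi. Qed.

Lemma merged_nodes_lt (i j : nat) :
  (forall a b, (nd a).1 = (nd b).1 -> (nd a).2 = (nd b).2) ->
  (i < j)%N -> (j < size s)%N -> (nth (0, 0) s i).1 < (nth (0, 0) s j).1.
Proof.
move=> hc ij hj; have hi := ltn_trans ij hj.
pose r (u v : R * R) := u.1 <= v.1.
have ss : sorted r s by apply: sort_sorted => u v; exact: le_total.
have tr : transitive r by move=> y x z; exact: le_trans.
have hle : (nth (0, 0) s i).1 <= (nth (0, 0) s j).1.
  by have h := sorted_ltn_nth tr (0, 0) ss; apply: (h i j).
rewrite lt_neqAle hle andbT; apply/negP => /eqP E1.
have [a aE] := nth_merged_nodes hi; have [b bE] := nth_merged_nodes hj.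
(* Equal first coordinates would make the two nodes equal, which [undup] excludes. *)
have E : nth (0, 0) s i = nth (0, 0) s j.
  move: E1; rewrite aE bE => E1; have E2 := hc _ _ E1.
  by case: (nd a) (nd b) E1 E2 => [? ?] [? ?] /= -> ->.
move/eqP: E; rewrite nth_uniq ?sort_uniq ?undup_uniq // => /eqP E.
by rewrite E ltnn in ij.
Qed.

Lemma feasible_supported : feasible al H p -> (forall i, 0 < lat_m p i) ->
  0 < cur_m p -> exists2 sg, supported sg & prescribed sg.
Proof.
move=> [hc hcon hlast hlat hcur] lat0 cur0.
have hlt := merged_nodes_lt hc.
have key (a : label T) (mu : R) : slope_ok s (nd a).1 mu ->
    forall b, (nd b).2 <= (nd a).2 + mu * ((nd b).1 - (nd a).1).
  move=> ok b; have [i hi E] := node_index a; rewrite -E in ok *.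
  have [k hk <-] := node_index b.
  by apply: support_of_secants => //; apply: (ok i.+1).
have [sg hsg] : {sg : label T -> R & forall a, [/\ 0 < sg a,
    forall b, (nd b).2 <= (nd a).2 + sg a * ((nd b).1 - (nd a).1),
    forall i, a = inl (inr i) -> sg a = lat_m p i &
    a = inr false -> sg a = cur_m p]}.
  apply: (@choice _ _ (fun a mu => [/\ 0 < mu,
    forall b, (nd b).2 <= (nd a).2 + mu * ((nd b).1 - (nd a).1),
    forall i, a = inl (inr i) -> mu = lat_m p i &
    a = inr false -> mu = cur_m p])) => a.
  have other : exists2 mu : R, 0 < mu &
      forall b, (nd b).2 <= (nd a).2 + mu * ((nd b).1 - (nd a).1).
    have [i hi <-] := node_index a.
    have [mu mu0 h] := support_exists hlt hcon hlast hi.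
    by exists mu => // b; have [k hk <-] := node_index b; exact: h.
  case: a other => [[i|i]|[]] other.
  - by case: other => mu mu0 h; exists mu.
  - exists (lat_m p i); split=> //; first exact: (key (inl (inr i)) _ (hlat i)).
    by move=> j [->].
  - by case: other => mu mu0 h; exists mu.
  - by exists (cur_m p); split=> //; exact: (key (inr false) _ hcur).
exists sg; split.
- by move=> a; case: (hsg a).
- by move=> a; case: (hsg a).
- by move=> i; case: (hsg (inl (inr i))) => _ _ h _; exact: h.
- by case: (hsg (inr false)) => _ _ _; apply.
Qed.

Lemma supported_feasible (sg : label T -> R) : supported sg -> prescribed sg ->
  feasible al H p.
Proof.
move=> [sg0 hsg] [hlat hcur].
have hc a b : (nd a).1 = (nd b).1 -> (nd a).2 = (nd b).2.
  move=> E; apply/le_anti; have := hsg a b; have := hsg b a.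
  by rewrite E subrr !mulr0 !addr0 => -> ->.
have hlt := merged_nodes_lt hc.
have [lab labE] : {lab : nat -> label T & forall i, (i < size s)%N ->
    nth (0, 0) s i = nd (lab i)}.
  apply: (@choice _ _ (fun i a => (i < size s)%N -> nth (0, 0) s i = nd a)) => i.
  have [/nth_merged_nodes[a h]|h] := ltnP i (size s); first by exists a.
  by exists (inr true).
have h0 i : (i < size s)%N -> 0 < sg (lab i) by [].
have h1 i k : (i < size s)%N -> (k < size s)%N -> (nth (0, 0) s k).2 <=
    (nth (0, 0) s i).2 + sg (lab i) * ((nth (0, 0) s k).1 - (nth (0, 0) s i).1).
  by move=> hi hk; rewrite !labE.
have ok a : slope_ok s (nd a).1 (sg a).
  case=> [//|j] /andP[_ hj] E; rewrite /nodeat /= in E.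
  have E' : nth (0, 0) s j = nd a.
    have [b bE] := nth_merged_nodes hj; rewrite bE in E *.
    have E2 := hc _ _ E.
    by case: (nd a) (nd b) E E2 => [? ?] [? ?] /= -> ->.
  apply: secant_le_slope => // k hk; rewrite E'.
  by have [b ->] := nth_merged_nodes hk.
split=> //.
- exact: (secants_nonincreasing hlt h0 h1).
- exact: (last_secant_gt0 hlt h0 h1 merged_nodes_gt0).
- by move=> i; rewrite -hlat; exact: (ok (inl (inr i))).
- by rewrite -hcur; exact: (ok (inr false)).
Qed.

End SupportedConfigurations.

(** * Configurations and outcomes *)

Lemma exists_lt_family (R : realType) (I : finType) (f : I -> R) (d : R) :
  0 < d -> (forall a, 0 < f a) ->
  exists e, [/\ 0 < e, e <= d & forall a, e < f a].
Proof.
move=> d0 f0; pose M := \big[Order.min/d]_a f a.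
have M0 : 0 < M by apply: lt_bigmin.
have hM : M / 2 < M by lra.
exists (M / 2); split; first lra.
- exact: le_trans (ltW hM) (bigmin_le_id _ _ _ _).
- by move=> a; apply: lt_le_trans hM (bigmin_le _ _ _).
Qed.

Lemma lines_nonpos (R : realType) (l : seq (R * R)) :
  (forall u, u \in l -> 0 < u.2) ->
  exists c, forall s, s <= c -> forall u, u \in l -> line u s <= 0.
Proof.
elim: l => [|u l IH] hl; first by exists 0.
have [c hc] := IH (fun v vl => hl v (@mem_behead _ (u :: l) v vl)).
have u0 := hl u (mem_head _ _).
exists (Num.min c (- u.1 / u.2)) => s; rewrite le_min => /andP[sc su] v.
rewrite inE => /predU1P[->|]; last exact: hc.
by move: su; rewrite ler_pdivlMr // /line; lra.
Qed.

Section RealizeConfiguration.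
Variables (R : realType) (T : nat) (al : R) (H : history R T).
Variables (eta : 'I_T -> R) (w0 eta0 : R) (p : config R T) (sg : label T -> R).
Hypotheses (hal : 0 <= al <= 1) (hH : valid_history H).
Hypothesis conf : configuration al H eta w0 eta0 p.
Hypotheses (sup : supported al H p sg) (pre : prescribed p sg).
Local Notation nd := (node al H p).

Definition node_line (a : label T) : R * R :=
  ((nd a).1 - (nd a).2 / sg a, (sg a)^-1).

Let sg0 a : 0 < sg a. Proof. by case: sup. Qed.

Lemma node_lineE (a : label T) (s : R) :
  line (node_line a) s = (nd a).1 + (s - (nd a).2) / sg a.
Proof. by rewrite /line /=; field; rewrite gt_eqF. Qed.

Lemma node_line_le (a b : label T) : line (node_line a) (nd b).2 <= (nd b).1.
Proof.
rewrite node_lineE -lerBrDl ler_pdivrMr // mulrC.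
by have := sup.2 a b; lra.
Qed.

Lemma node_x_ge0 (a : label T) : 0 <= (nd a).1.
Proof.
case: conf => h1 [h2 _ _] [h3 _ _]; case: hH => _ _ hq _.
case: a => [[i|i]|[]] //=; last by case: (h1 i).
by have /andP[q0 q1] := hq i; rewrite xcoord_ge0 // ltW.
Qed.

Definition last_node : label T := [arg max_(e > inr true) (nd e).1]%O.

Lemma last_nodeP (a : label T) : (nd a).1 <= (nd last_node).1.
Proof. by rewrite /last_node; case: Order.TotalTheory.arg_maxP => // e _; apply. Qed.

Lemma last_node_price (a : label T) : (nd a).2 <= (nd last_node).2.
Proof.
have := sup.2 last_node a.
have : sg last_node * ((nd a).1 - (nd last_node).1) <= 0.
  by rewrite pmulr_rle0 // subr_le0 last_nodeP.
lra.
Qed.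

(* The line of slope [eps] below all the prescribed slopes makes each latent
   optimum strictly better than any price beyond the last node, which is what
   makes the argmax sets compact when [al = 0]. *)
Definition end_line (eps : R) : R * R :=
  ((nd last_node).1 - (nd last_node).2 / eps, eps^-1).

Lemma end_lineE (eps s : R) : 0 < eps ->
  line (end_line eps) s = (nd last_node).1 + (s - (nd last_node).2) / eps.
Proof. by move=> e0; rewrite /line /=; field; rewrite gt_eqF. Qed.

Lemma end_line_le (eps : R) (a : label T) : 0 < eps ->
  (forall c, eps < sg c) -> line (end_line eps) (nd a).2 <= (nd a).1.
Proof.
move=> e0 he; rewrite end_lineE // -lerBrDl ler_pdivrMr //.
have h1 := sup.2 last_node a; have h2 := last_nodeP a.
have : sg last_node * ((nd a).1 - (nd last_node).1) <=
    eps * ((nd a).1 - (nd last_node).1).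
  by rewrite ler_wnM2r ?subr_le0 // ltW.
lra.
Qed.

(** * Demand curves enveloping a possibly infinite family of lines *)

Section Curve.
Variables (b : \bar R) (X : R -> R) (S : set (R * R)) (eps : R).
Hypotheses (eps0 : 0 < eps) (heps : forall a, eps < sg a).
Hypothesis S0 : forall u, S u -> 0 < u.2.
Hypothesis S_node : forall a, S (node_line a).
Hypothesis S_end : S (end_line eps).
Hypothesis S_le : forall u a, S u -> line u (nd a).2 <= (nd a).1.
Hypothesis nd_b : forall a, ((nd a).2%:E < b)%E.
Hypothesis envX : forall s, (s%:E < b)%E ->
  [/\ 0 <= X s, forall u, S u -> line u s <= X s &
      X s = 0 \/ exists2 u, S u & X s = line u s].
Hypothesis zeroS : exists2 s, (s%:E < b)%E & forall u, S u -> line u s <= 0.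
Hypothesis unbX : forall C, exists2 s, (s%:E < b)%E & C <= X s.
Local Notation F := (curve_cdf al b X).

Let X0 s : (s%:E < b)%E -> 0 <= X s. Proof. by case/envX. Qed.

Let lineX u s : (s%:E < b)%E -> S u -> line u s <= X s.
Proof. by case/envX => _ h _; exact: h. Qed.

Let subX s : (s%:E < b)%E -> exists d : R,
  [/\ 0 <= d, 0 < X s -> 0 < d &
      forall t, (t%:E < b)%E -> X s + d * (t - s) <= X t].
Proof.
move=> sb; have [_ _ [Xs|[u Su Xs]]] := envX sb.
  by exists 0; split=> // [|t tb]; rewrite Xs ?ltxx // mul0r addr0 X0.
exists u.2; split=> [||t tb]; rewrite ?S0 //; first by rewrite ltW // S0.
have := lineX tb Su; rewrite Xs /line; lra.
Qed.

Let zeroX : exists2 s, (s%:E < b)%E & X s = 0.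
Proof.
have [s sb hs] := zeroS; exists s => //.
have [X0s _ [//|[u Su Xs]]] := envX sb.
by apply/le_anti; rewrite X0s Xs hs.
Qed.

Lemma curve_at_node (a : label T) : X (nd a).2 = (nd a).1.
Proof.
have [_ h Xa] := envX (nd_b a); apply/le_anti/andP; split.
  by case: Xa => [->|[u Su ->]]; [exact: node_x_ge0|exact: S_le].
by apply: le_trans (h _ (S_node a)); rewrite node_lineE subrr mul0r addr0.
Qed.

Lemma tail_at_node (a : label T) : tail F (nd a).2 = Gammabar al (nd a).1.
Proof. by rewrite tail_curve // curve_at_node. Qed.

Lemma node_response (a : label T) (w : R) :
  (nd a).2 = w + (1 + (1 - al) * (nd a).1) * sg a ->
  responses F w (nd a).2 /\ well_posed F w.
Proof.
move=> E.
have E' : (nd a).2 = w + (1 + (1 - al) * X (nd a).2) * sg a by rewrite curve_at_node.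
have resp : responses F w (nd a).2.
  apply: (curve_response hal X0 (nd_b a) (sg0 a) E') => t tb.
  by rewrite curve_at_node -node_lineE; exact: lineX.
split=> //; split; first by exists (nd a).2.
(* Past the last node the end line, of slope [eps^-1 > (sg a)^-1] in the price, runs strictly above
   the line of [a]. *)
apply: (curve_responses_compact hal X0 subX zeroX unbX (nd_b a) (sg0 a) E'
  (B := (nd last_node).2)) => u Bu ub.
apply: lt_le_trans (lineX ub S_end); rewrite curve_at_node end_lineE //.
have := node_line_le a last_node; rewrite node_lineE => h1.
have h2 : (u - (nd last_node).2) / sg a < (u - (nd last_node).2) / eps.
  by rewrite ltr_pM2l ?subr_gt0 // ltf_pV2 ?posrE ?heps.
have : (u - (nd a).2) / sg a =
    (u - (nd last_node).2) / sg a + ((nd last_node).2 - (nd a).2) / sg a by ring.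
lra.
Qed.

Lemma edist_set_le_elt (A : set R) (s r e : R) : A r -> `|s - r| <= e ->
  (edist_set s A <= e%:E)%E.
Proof.
by move=> Ar h; apply: ge_ereal_inf; exists `|s - r|%:E; [exists r|rewrite lee_fin].
Qed.

Lemma realize_class : [/\ class_PE al H eta F, well_posed F w0 &
  responses F w0 (cur_r p)].
Proof.
case: conf => h1 [_ _ curE] _; case: (pre) => pre1 pre2; case: hH => _ _ hq _.
have lat i : responses F (hw H i) (lat_s p i) /\ well_posed F (hw H i).
  apply: (@node_response (inl (inr i))); rewrite /= pre1.
  by case: (h1 i).
have [cur1 cur2] : responses F w0 (cur_r p) /\ well_posed F w0.
  by apply: (@node_response (inr false)); rewrite /= pre2.
split=> //; split.
- split; first exact: curve_regular.
  move=> i; rewrite (tail_at_node (inl (inl i))) /= GammabarK //.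
  by case/andP: (hq i).
- by move=> i; case: (lat i).
- move=> i; apply: (edist_set_le_elt (r := lat_s p i)); first by case: (lat i).
  by rewrite distrC; case: (h1 i).
Qed.

End Curve.

Lemma realize_piecewise : exists F : R -> R,
  [/\ outcomes al H eta w0 eta0 (F, rea_y p),
      tail F (rea_y p) = realized_demand al p & piecewise_Gbar al (tail F)].
Proof.
have [eps [e0 _ heps]] := exists_lt_family ltr01 sg0.
pose l := end_line eps :: [seq node_line a | a : label T].
have l0 u : u \in l -> 0 < u.2.
  by rewrite inE => /predU1P[->|/mapP[a _ ->]] /=; rewrite invr_gt0.
have [c hc] := lines_nonpos l0.
pose S := [set u | u \in l].
have S_node a : S (node_line a) by rewrite /S /= inE map_f ?mem_enum ?orbT.
have S_end : S (end_line eps) by rewrite /S /= mem_head.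
have S_le u a : S u -> line u (nd a).2 <= (nd a).1.
  rewrite /S /= inE => /predU1P[->|/mapP[d _ ->]].
    exact: end_line_le.
  exact: node_line_le.
have envX s : (s%:E < +oo)%E -> [/\ 0 <= maxl l s,
    forall u, S u -> line u s <= maxl l s &
    maxl l s = 0 \/ exists2 u, S u & maxl l s = line u s].
  move=> _; split; first exact: maxl_ge0.
  - by move=> u; exact: line_le_maxl.
  - exact: maxl_attained.
have zeroS : exists2 s, (s%:E < +oo)%E & forall u, S u -> line u s <= 0.
  by exists c; rewrite ?ltry //; exact: hc.
have unbX C : exists2 s, (s%:E < +oo)%E & C <= maxl l s.
  exists ((nd last_node).2 + eps * C); first exact: ltry.
  apply: le_trans (line_le_maxl _ S_end); rewrite end_lineE //.
  have -> : ((nd last_node).2 + eps * C - (nd last_node).2) / eps = C.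
    by field; rewrite gt_eqF.
  by rewrite lerDr node_x_ge0.
have nd_b a : ((nd a).2%:E < +oo)%E by exact: ltry.
pose F := curve_cdf al +oo%E (maxl l).
have [c1 c2 c3] := realize_class e0 heps l0 S_node S_end S_le nd_b envX zeroS unbX.
exists F; split.
- case: conf => _ _ [_ h1 h2]; split=> //; split=> //=.
  by apply: edist_set_le_elt c3 _.
- exact: (tail_at_node S_node S_le nd_b envX (inr true)).
- apply: (@piecewise_Gbar_maxl _ _ hal l) => // s _.
  by rewrite tail_curve // ltry.
Qed.

(** * Curves whose demand vanishes at a finite price *)

Section Exhausting.
Variables (eps : R).
Hypotheses (eps0 : 0 < eps) (heps : forall a, eps < sg a).
Local Notation xe := (nd last_node).1.
Local Notation ve := (nd last_node).2.

(* Beyond the last node the price curve gets slopes [eps / 2 ^ k], so that it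
   increases to the finite limit [ve + 2 * eps]. *)
Definition tail_price (k : nat) : R := ve + 2 * eps * (1 - 2^-1 ^+ k).
(** The line through price [tail_price k] at height [xe + k]. It meets the next one at
    [tail_price k.+1], where both have height [xe + k + 1]. *)
Definition tail_line (k : nat) : R * R :=
  (xe + k%:R - 2 ^+ k / eps * tail_price k, 2 ^+ k / eps).

Lemma tail_lineE (k : nat) (s : R) :
  line (tail_line k) s = xe + k%:R + 2 ^+ k / eps * (s - tail_price k).
Proof. by rewrite /line /=; ring. Qed.

Lemma tail_priceS (k : nat) : tail_price k.+1 = tail_price k + eps / 2 ^+ k.
Proof.
rewrite /tail_price exprS -exprVn.
have : 2 * eps * (2^-1 * 2^-1 ^+ k) = eps * 2^-1 ^+ k.
  by field.
lra.
Qed.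

Lemma tail_price0 : tail_price 0 = ve.
Proof. by rewrite /tail_price expr0 subrr mulr0 addr0. Qed.

Lemma tail_price_mono (j k : nat) : (j <= k)%N -> tail_price j <= tail_price k.
Proof.
elim: k => [|k IH]; first by rewrite leqn0 => /eqP->.
rewrite leq_eqVlt ltnS => /predU1P[->//|/IH h]; apply: le_trans h _.
by rewrite tail_priceS lerDl divr_ge0 ?exprn_ge0 // ltW.
Qed.

Lemma tail_price_lt (k : nat) : tail_price k < ve + 2 * eps.
Proof.
by rewrite /tail_price ltrD2l gtr_pMr ?mulr_gt0 // gtrBl exprn_gt0.
Qed.

Lemma tail_price_cofinal (s : R) : s < ve + 2 * eps ->
  exists k, s <= tail_price k.
Proof.
move=> sb; pose g := ve + 2 * eps - s; have g0 : 0 < g by rewrite subr_gt0.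
have [k hk] : exists k : nat, 2 * eps / g < 2 ^+ k.
  exists (Num.truncn (2 * eps / g)).+1; apply: lt_le_trans (truncnS_gt _) _.
  by rewrite -natrX ler_nat ltnW // ltn_expl.
exists k; rewrite /tail_price mulrBr mulr1 exprVn.
have : 2 * eps / 2 ^+ k < g.
  by rewrite ltr_pdivrMr ?exprn_gt0 // [ltRHS]mulrC -ltr_pdivrMr.
rewrite /g; lra.
Qed.

Lemma tail_line0 : tail_line 0 = end_line eps.
Proof.
by rewrite /tail_line /end_line tail_price0 expr0 div1r addr0 [_ / eps]mulrC.
Qed.

Lemma tail_line_cut (K k : nat) (s : R) : s <= tail_price K -> (K <= k)%N ->
  line (tail_line k) s <= line (tail_line K) s.
Proof.
move=> sK; elim: k => [|k IH]; first by rewrite leqn0 => /eqP->.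
rewrite leq_eqVlt ltnS => /predU1P[->//|Kk]; apply: le_trans (IH Kk).
rewrite -subr_le0 !tail_lineE.
have -> : xe + k.+1%:R + 2 ^+ k.+1 / eps * (s - tail_price k.+1) -
    (xe + k%:R + 2 ^+ k / eps * (s - tail_price k)) =
    2 ^+ k / eps * (s - tail_price k.+1).
  rewrite tail_priceS exprS -natr1.
  by field; rewrite !gt_eqF ?exprn_gt0.
rewrite pmulr_rle0; last by rewrite divr_gt0 // exprn_gt0.
by rewrite subr_le0; apply: le_trans sK _; apply: tail_price_mono; exact: leqW.
Qed.

Lemma realize_exhausted (y : R) : ve + 2 * eps <= y -> w0 <= y ->
  `|y - cur_r p| <= eta0 -> exists F : R -> R,
  [/\ outcomes al H eta w0 eta0 (F, y), tail F y = 0 &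
      locally_piecewise_Gbar al (tail F)].
Proof.
move=> by_ w0y yr; pose b := (ve + 2 * eps)%:E.
pose lK K := [seq tail_line k | k <- iota 0 K.+1] ++ [seq node_line a | a : label T].
pose S := [set u | (exists k, u = tail_line k) \/ exists a, u = node_line a].
have S0 u : S u -> 0 < u.2.
  case=> [[k ->]|[a ->]] /=; last by rewrite invr_gt0.
  by rewrite divr_gt0 // exprn_gt0.
have S_node a : S (node_line a) by right; exists a.
have S_end : S (end_line eps) by left; exists 0; rewrite tail_line0.
have S_le u a : S u -> line u (nd a).2 <= (nd a).1.
  case=> [[k ->]|[d ->]]; last exact: node_line_le.
  apply: le_trans (_ : line (tail_line 0) (nd a).2 <= _).
    by apply: tail_line_cut => //; rewrite tail_price0 last_node_price.
  by rewrite tail_line0 end_line_le.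
have nd_b a : ((nd a).2%:E < b)%E.
  by rewrite lte_fin (le_lt_trans (last_node_price a)) // ltrDl mulr_gt0.
have lKS K u : u \in lK K -> S u.
  rewrite mem_cat => /orP[/mapP[k _ ->]|/mapP[a _ ->]]; first by left; exists k.
  by right; exists a.
have tlK K k : (k <= K)%N -> tail_line k \in lK K.
  by move=> kK; rewrite mem_cat map_f // mem_iota.
have nlK K a : node_line a \in lK K.
  by rewrite mem_cat orbC map_f // mem_enum.
have le_lK K s u : s <= tail_price K -> S u -> line u s <= maxl (lK K) s.
  move=> sK [[k ->]|[a ->]]; last exact/line_le_maxl/nlK.
  have [kK|Kk] := leqP k K; first exact/line_le_maxl/tlK.
  apply: le_trans (tail_line_cut sK (ltnW Kk)) _.
  exact/line_le_maxl/tlK.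
(* By the previous lemma the supremum over the infinite family is, at each price below [b], a
   maximum over a finite list, hence attained. *)
have [X envX] : {X : R -> R & forall s, (s%:E < b)%E -> [/\ 0 <= X s,
    forall u, S u -> line u s <= X s &
    X s = 0 \/ exists2 u, S u & X s = line u s]}.
  apply: (@choice _ _ (fun s x => (s%:E < b)%E -> [/\ 0 <= x,
    forall u, S u -> line u s <= x &
    x = 0 \/ exists2 u, S u & x = line u s])) => s.
  have [sb|sb] := ltP s%:E b; last by exists 0.
  rewrite lte_fin in sb; have [K sK] := tail_price_cofinal sb.
  exists (maxl (lK K) s) => _; split; first exact: maxl_ge0.
  - by move=> u; exact: le_lK.
  - case: (maxl_attained (lK K) s) => [->|[u /lKS Su ->]]; [by left|right].
    by exists u.
have X_lK K s : s <= tail_price K -> X s = maxl (lK K) s.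
  move=> sK; have sb : (s%:E < b)%E.
    by rewrite lte_fin (le_lt_trans sK) // tail_price_lt.
  have [X0 hX Xs] := envX s sb; apply/le_anti/andP; split.
  - by case: Xs => [->|[u Su ->]]; [exact: maxl_ge0|exact: le_lK].
  - by apply: maxl_le => // u /lKS; exact: hX.
have zeroS : exists2 s, (s%:E < b)%E & forall u, S u -> line u s <= 0.
  have [c hc] := @lines_nonpos _ (lK 0) (fun u ul => S0 u (lKS _ _ ul)).
  have sv : Num.min c ve <= tail_price 0 by rewrite tail_price0 ge_min lexx orbT.
  exists (Num.min c ve).
    by rewrite lte_fin (le_lt_trans sv) // tail_price_lt.
  move=> u Su; apply: le_trans (le_lK _ _ _ sv Su) _.
  by apply: maxl_le => // v vl; apply: hc vl; rewrite ge_min lexx.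
have unbX C : exists2 s, (s%:E < b)%E & C <= X s.
  pose k := (Num.truncn C).+1; have sb : ((tail_price k)%:E < b)%E.
    by rewrite lte_fin tail_price_lt.
  exists (tail_price k) => //; have [_ hX _] := envX _ sb.
  apply: le_trans (hX (tail_line k) _); last by left; exists k.
  rewrite tail_lineE subrr mulr0 addr0 ler_wpDl ?node_x_ge0 //.
  exact: ltW (truncnS_gt _).
pose F := curve_cdf al b X.
have [c1 c2 c3] := realize_class eps0 heps S0 S_node S_end S_le nd_b envX zeroS unbX.
exists F; split.
- by split=> //; split=> //=; apply: edist_set_le_elt c3 _.
- by rewrite tail_curve_end // lee_fin.
- move=> c c0; have [C C0 hC] := Gammabar_small hal c0.
  pose K := (Num.truncn C).+1.
  (* Beyond [tail_price K] the curve has height at least [K > C], where demand is below [c]. *)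
  have DK s : c <= tail F s -> s <= tail_price K.
    move=> cs; have [sb|sb] := ltP s%:E b; last first.
      by move: cs; rewrite tail_curve_end // leNgt c0.
    rewrite leNgt; apply/negP => Ks; move: cs; rewrite tail_curve // leNgt.
    rewrite hC //; have [_ hX _] := envX _ sb.
    apply: le_trans (hX (tail_line K) _); last by left; exists K.
    rewrite tail_lineE; apply: le_trans (ltW (truncnS_gt C)) _.
    rewrite -/K addrAC lerDr addr_ge0 ?node_x_ge0 //.
    by rewrite mulr_ge0 ?subr_ge0 ?(ltW Ks) // divr_ge0 ?exprn_ge0 // ltW.
  apply: (@piecewise_Gbar_maxl _ _ hal (lK K)) => //.
    by move=> u /lKS; exact: S0.
  move=> s /DK sK; have sb : (s%:E < b)%E.
    by rewrite lte_fin (le_lt_trans sK) // tail_price_lt.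
  by rewrite tail_curve // (X_lK K).
Qed.

End Exhausting.

End RealizeConfiguration.

(** * Reading a configuration off an outcome *)

Section ConfigurationOfOutcome.
Variables (R : realType) (T : nat) (al : R) (H : history R T).
Variables (eta : 'I_T -> R) (w0 eta0 : R) (F : R -> R).
Hypotheses (hal : 0 <= al <= 1) (hH : valid_history H).
Hypothesis FPE : class_PE al H eta F.
Hypothesis Fwp : well_posed F w0.
Local Notation q := (tail F).
Local Notation X := (fun s => xcoord al (tail F s)).

(** The last hypothesis provides a support at the realized price: a subgradient where demand is
    below 1, the optimality support when the price is [r0]. The last two conclusions serve to
    rebuild a curve when the original realized demand is 0. *)
Lemma outcome_config (r0 y : R) : responses F w0 r0 -> 0 < q y ->
  `|y - r0| <= eta0 -> w0 <= y -> q y < 1 \/ y = r0 ->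
  exists p : config R T, [/\ configuration al H eta w0 eta0 p,
    exists2 sg, supported al H p sg & prescribed p sg,
    realized_demand al p = q y,
    cur_r p = r0 &
    forall a, 0 < q (node al H p a).2].
Proof.
move=> resp0 qy0 yr w0y hy.
case: FPE => -[[f [dF fpos reg]] qE] wp dist; case: (hH) => _ _ hq _.
have [r hr] : {r : 'I_T -> R & forall i,
    responses F (hw H i) (r i) /\ `|hs H i - r i| <= eta i}.
  apply: (@choice _ _ (fun i s => responses F (hw H i) s /\ `|hs H i - s| <= eta i)).
  move=> i; have [ne cpt] := wp i.
  by have [s ? ?] := edist_set_le ne cpt (dist i); exists s.
have inner i : hw H i < r i /\ 0 < q (r i).
  apply: (compact_response_interior dF) (proj1 (hr i)).
  by case: (wp i).
have [w0r0 qr0] := compact_response_interior dF (proj2 Fwp) resp0.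
pose e s := 1 + (1 - al) * X s.
have e0 s : 0 < q s -> 0 < e s by exact: xcoord_dom.
have eE (w s : R) : 0 < q s -> s = w + e s * ((s - w) / e s).
  by move=> qs; rewrite mulrCA divff ?gt_eqF ?e0 // mulr1 addrC subrK.
have Xge0 s : 0 < q s -> 0 <= X s.
  by move=> qs; rewrite xcoord_ge0 // (tail_le1 dF).
pose p := @Config R T (fun i => X (r i)) r
  (fun i => (r i - hw H i) / e (r i)) (X r0) r0 ((r0 - w0) / e r0) (X y) y.
have nodeE a : (node al H p a).1 = X (node al H p a).2.
  by case: a => [[i|i]|[]] //=; rewrite qE.
have qnode a : 0 < q (node al H p a).2.
  case: a => [[i|i]|[]] //=; last by case: (inner i).
  by rewrite qE; case/andP: (hq i).
(* The reciprocal of the subgradient of [X], that is, a slope of the price curve. *)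
pose g s := (e s * (f s / q s))^-1.
have g_sup s t : 0 < q s < 1 -> 0 < q t -> 0 < g s /\ t <= s + g s * (X t - X s).
  move=> qs qt; have /andP[qs0 _] := qs.
  have d0 : 0 < e s * (f s / q s) by rewrite mulr_gt0 ?e0 // divr_gt0 // fpos.
  rewrite /g invr_gt0; split=> //.
  rewrite -lerBlDl mulrC ler_pdivlMr //.
  by have := regular_subgradient hal dF fpos reg qs qt; rewrite -/(e s); lra.
pose sg (a : label T) : R := match a with
  | inl (inl i) => g (hs H i)
  | inl (inr i) => (r i - hw H i) / e (r i)
  | inr false => (r0 - w0) / e r0
  | inr true => if q y < 1 then g y else (r0 - w0) / e r0
  end.
have cur_sup t : 0 < q t ->
    0 < (r0 - w0) / e r0 /\ t <= r0 + (r0 - w0) / e r0 * (X t - X r0).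
  move=> qt; split; first by rewrite divr_gt0 ?e0 // subr_gt0.
  exact: (response_supports hal dF fpos reg resp0).
have lat_sup i t : 0 < q t -> 0 < (r i - hw H i) / e (r i) /\
    t <= r i + (r i - hw H i) / e (r i) * (X t - X (r i)).
  have [h1 h2] := inner i; move=> qt.
  split; first by rewrite divr_gt0 ?e0 // subr_gt0.
  exact: (response_supports hal dF fpos reg (proj1 (hr i))).
have sup a t : 0 < q t -> 0 < sg a /\
    t <= (node al H p a).2 + sg a * (X t - X (node al H p a).2).
  case: a => [[i|i]|[]] qt /=.
  - by apply: g_sup => //; rewrite qE.
  - exact: lat_sup.
  - case: ifPn => [qy1|qy1]; first by apply: g_sup => //; rewrite qy0.
    case: hy => [h|->]; first by rewrite h in qy1.
    exact: cur_sup.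
  - exact: cur_sup.
exists p; split=> //.
- split.
  + move=> i; have [h1 h2] := inner i; split=> /=.
    * exact: Xge0.
    * by case: (lat_sup i (r i) h2).
    * exact: eE.
    * by rewrite distrC; case: (hr i).
  + by split; [exact: Xge0|case: (cur_sup r0 qr0)|exact: eE].
  + by split=> //; exact: Xge0.
- exists sg; last by [].
  split; first by move=> a; case: (sup a y qy0).
  move=> a c; rewrite !nodeE; exact: (sup a _ (qnode c)).2.
- by rewrite /realized_demand /= GammabarK.
Qed.

End ConfigurationOfOutcome.

(** * Outcomes against feasible configurations *)

Section FiniteProgram.
Variables (R : realType) (T : nat) (al : R) (H : history R T).
Variables (eta : 'I_T -> R) (w0 eta0 : R).
Hypotheses (hal : 0 <= al <= 1) (hH : valid_history H).

Definition feasible_configs : set (config R T) :=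
  [set p | configuration al H eta w0 eta0 p /\ feasible al H p].

Lemma feasible_outcome (p : config R T) : feasible_configs p ->
  exists F : R -> R, [/\ outcomes al H eta w0 eta0 (F, rea_y p),
    tail F (rea_y p) = realized_demand al p & piecewise_Gbar al (tail F)].
Proof.
move=> [conf feas]; case: (conf) => lat [_ cur0 _] _.
have lat0 i : 0 < lat_m p i by case: (lat i).
have [sg sup pre] := feasible_supported feas lat0 cur0.
exact: (realize_piecewise hal hH conf sup pre).
Qed.

Lemma outcome_response (F : R -> R) (y : R) : outcomes al H eta w0 eta0 (F, y) ->
  exists r0, [/\ responses F w0 r0, `|y - r0| <= eta0, 0 < tail F r0 & w0 <= r0].
Proof.
move=> [/= cl wp [w0y dy]]; have [ne cpt] := wp.
have [r0 h1 h2] := edist_set_le ne cpt dy.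
case: cl => -[[f [dF _ _]] _] _ _.
have [h3 h4] := compact_response_interior dF cpt h1.
by exists r0; split=> //; exact: ltW.
Qed.

Lemma outcome_feasible (F : R -> R) (y : R) :
  outcomes al H eta w0 eta0 (F, y) -> 0 < tail F y ->
  exists2 p, feasible_configs p & realized_demand al p <= tail F y.
Proof.
move=> oc qy; have [r0 [resp yr qr w0r]] := outcome_response oc.
case: (oc) => /= cl wp [w0y _].
case: (cl) => -[[f [dF _ _]] _] _ _.
have [qy1|qy1] := ltP (tail F y) 1.
- have [p [h1 [sg h2 h3] h4 _ _]] :=
    outcome_config hal hH cl wp resp qy yr w0y (or_introl qy1).
  exists p; last by rewrite h4.
  by split=> //; exact: supported_feasible h2 h3.
- have eta00 : `|r0 - r0| <= eta0 by rewrite subrr normr0 (le_trans _ yr).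
  have [p [h1 [sg h2 h3] h4 _ _]] :=
    outcome_config hal hH cl wp resp qr eta00 w0r (or_intror erefl).
  exists p; first by split=> //; exact: supported_feasible h2 h3.
  by rewrite h4; apply: le_trans qy1; exact: (tail_le1 dF).
Qed.

Lemma exhausted_outcome_feasible (F : R -> R) (y c : R) :
  outcomes al H eta w0 eta0 (F, y) -> tail F y = 0 -> 0 < c ->
  exists2 p, feasible_configs p & realized_demand al p <= c.
Proof.
move=> oc qy c0; have [r0 [resp yr qr w0r]] := outcome_response oc.
case: (oc) => /= cl wp [w0y _].
case: (cl) => -[[f [dF _ _]] _] _ _.
have r0y : r0 <= y.
  by rewrite leNgt; apply/negP => /ltW/(tail_mono dF); rewrite qy leNgt qr.
(* A level strictly between the demands at [y] and [r0]: the price attaining it lies between [r0]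
   and [y], hence within the radius and above [w0], and its demand is below 1. *)
pose c' := Num.min c (tail F r0 / 2).
have c'0 : 0 < c' by rewrite lt_min c0 divr_gt0.
have c'q : c' <= tail F r0 / 2 by rewrite ge_min lexx orbT.
have q1 := tail_le1 dF r0.
have [u /andP[r0u uy] qu] : exists2 u, r0 <= u <= y & tail F u = c'.
  by apply: (tail_value dF) => //; [rewrite qy ltW|lra].
have ur : `|u - r0| <= eta0.
  rewrite ger0_norm ?subr_ge0 //; apply: le_trans yr.
  by rewrite ger0_norm ?subr_ge0 // lerD2r.
have qu0 : 0 < tail F u by rewrite qu.
have qu1 : tail F u < 1 by rewrite qu; lra.
have [p [h1 [sg h2 h3] h4 _ _]] := outcome_config hal hH cl wp resp qu0 ur
  (le_trans w0r r0u) (or_introl qu1).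
exists p; first by split=> //; exact: supported_feasible h2 h3.
by rewrite h4 qu ge_min lexx.
Qed.

Lemma exhausted_outcome_piecewise (F : R -> R) (y : R) :
  outcomes al H eta w0 eta0 (F, y) -> tail F y = 0 -> exists G : R -> R,
  [/\ outcomes al H eta w0 eta0 (G, y), tail G y = 0 &
      locally_piecewise_Gbar al (tail G)].
Proof.
move=> oc qy; have [r0 [resp yr qr w0r]] := outcome_response oc.
case: (oc) => /= cl wp [w0y _].
case: (cl) => -[[f [dF _ _]] _] _ _.
have eta00 : `|r0 - r0| <= eta0 by rewrite subrr normr0 (le_trans _ yr).
have [p [h1 [sg h2 h3] h4 h5 h6]] :=
  outcome_config hal hH cl wp resp qr eta00 w0r (or_intror erefl).
pose v := (node al H p (last_node al H p)).2.
have vy : v < y.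
  rewrite ltNge; apply/negP => /(tail_mono dF); rewrite qy leNgt.
  by rewrite h6.
(* All nodes have positive demand, so the last one lies strictly below [y]. This choice makes the
   support end at [v + 2 * eps <= y]. *)
have d0 : 0 < (y - v) / 2 by rewrite divr_gt0 // subr_gt0.
have [eps [e0 ed he]] := exists_lt_family d0 (proj1 h2).
apply: (realize_exhausted hal hH h1 h2 h3 e0 he) => //.
- by rewrite -/v; lra.
- by rewrite h5.
Qed.

Lemma tail_outcome_ge0 (F : R -> R) (y : R) :
  outcomes al H eta w0 eta0 (F, y) -> 0 <= tail F y.
Proof. by move=> [/= [[[f [dF _ _]] _] _ _] _ _]; exact: (tail_ge0 dF). Qed.

Lemma qmin_feasible : qmin al H eta w0 eta0 =
  ereal_inf [set (realized_demand al p)%:E | p in feasible_configs].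
Proof.
apply/le_anti/andP; split.
- apply: le_ereal_inf_tmp => _ [p hp <-].
  have [F [h1 h2 _]] := feasible_outcome hp.
  by apply: ge_ereal_inf; exists (realized_demand al p)%:E => //;
    exists (F, rea_y p) => //=; rewrite h2.
- apply: le_ereal_inf_tmp => _ [[F y] oc <-] /=.
  have [q0|q0] := eqVneq (tail F y) 0.
    apply/lee_addgt0Pr => c c0.
    have [p hp pc] := exhausted_outcome_feasible oc q0 c0.
    apply: ge_ereal_inf; exists (realized_demand al p)%:E; first by exists p.
    by rewrite q0 add0e lee_fin.
  have {q0} q0 : 0 < tail F y by rewrite lt_neqAle eq_sym q0 tail_outcome_ge0.
  have [p hp pc] := outcome_feasible oc q0.
  by apply: ge_ereal_inf; exists (realized_demand al p)%:E; [exists p|rewrite lee_fin].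
Qed.

Lemma feasible_orderings :
  ereal_inf [set (realized_demand al p)%:E | p in feasible_configs] =
  \big[Order.min/+oo%E]_(om : ordering T | om \in Omega al H eta w0 eta0)
    ereal_inf [set (realized_demand al p)%:E | p in program al H eta w0 eta0 om].
Proof.
apply/le_anti/andP; split.
- apply: le_bigmin => [|om _]; first exact: leey.
  by apply: ereal_inf_le_tmp => _ [p [h1 h2 _] <-]; exists p.
- apply: le_ereal_inf_tmp => _ [p [h1 h2] <-].
  have om : price_order al H p \in Omega al H eta w0 eta0 by rewrite inE; exists p.
  apply: le_trans (bigmin_le_cond _ _ om) _.
  by apply: ereal_inf_lbound; exists p.
Qed.

End FiniteProgram.

Theorem theorem3 (R : realType) (al : R) (T : nat) (H : history R T)
    (eta : 'I_T -> R) (eta0 w0 : R)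
    (hal : 0 <= al <= 1) (hH : valid_history H)
    (heta : forall i, 0 <= eta i) (heta0 : 0 <= eta0)
    (hQ : class_Q al H !=set0) :
  [/\ (* the finite-program formula *)
      qmin al H eta w0 eta0 =
        \big[Order.min/+oo%E]_(om : ordering T | om \in Omega al H eta w0 eta0)
          ereal_inf [set (realized_demand al p)%:E
                    | p in program al H eta w0 eta0 om],
      (* an attained worst case is piecewise generalized Pareto *)
      (worst_case al H eta w0 eta0 !=set0 ->
        exists Fy : (R -> R) * R,
          [/\ worst_case al H eta w0 eta0 Fy,
              locally_piecewise_Gbar al (tail Fy.1) &
              (0 < qmin al H eta w0 eta0)%E -> piecewise_Gbar al (tail Fy.1)]) &
      (* such curves approach the infimum, whether or not it is attained *)
      ((qmin al H eta w0 eta0 < +oo)%E ->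
        exists Fy : nat -> (R -> R) * R,
          (forall n, outcomes al H eta w0 eta0 (Fy n) /\
                     piecewise_Gbar al (tail (Fy n).1)) /\
          (fun n => (tail (Fy n).1 (Fy n).2)%:E) @ \oo -->
            qmin al H eta w0 eta0)].
Proof.
split; first by rewrite qmin_feasible // feasible_orderings.
- move=> [[F y] [oc /= qE]].
  have := tail_outcome_ge0 oc; rewrite le_eqVlt => /predU1P[q0|q0].
    have [G [h1 h2 h3]] := exhausted_outcome_piecewise hal hH oc (esym q0).
    exists (G, y); split=> //=; first by split=> //=; rewrite -qE h2 q0.
    by rewrite -qE -q0 ltxx.
  have [p hp pq] := outcome_feasible hal hH oc q0.
  have [G [h1 h2 h3]] := feasible_outcome hal hH hp.
  (* The rebuilt outcome cannot fall below the infimum, which [F] attains at [y], so its demand is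
     the same. *)
  have GE : tail G (rea_y p) = tail F y.
    apply/le_anti; rewrite h2 pq /= -h2 -lee_fin qE.
    by apply: ereal_inf_lbound; exists (G, rea_y p).
  exists (G, rea_y p); split=> //=; first by split=> //=; rewrite GE.
  move=> c c0; case: h3 => n [t [g [k1 k2 k3]]].
  by exists n, t, g; split=> // k s kn _; exact: k3.
- set m := qmin _ _ _ _ _ => moo.
  have m0 : (0 <= m)%E.
    apply: le_ereal_inf_tmp => _ [[F y] oc <-] /=; rewrite lee_fin.
    exact: tail_outcome_ge0 oc.
  have mfin : m \is a fin_num by rewrite ge0_fin_numE.
  have step n : exists Fy : (R -> R) * R, (outcomes al H eta w0 eta0 Fy /\
      piecewise_Gbar al (tail Fy.1)) /\ tail Fy.1 Fy.2 < fine m + n.+1%:R^-1.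
    have : (m < (fine m + n.+1%:R^-1)%:E)%E.
      by rewrite EFinD fineK // lteDl // lte_fin.
    rewrite {1}/m qmin_feasible // => /ereal_inf_lt[_ [p hp <-]].
    rewrite lte_fin => hlt; have [F [h1 h2 h3]] := feasible_outcome hal hH hp.
    by exists (F, rea_y p); rewrite /= h2.
  have [Fy hFy] := choice step.
  exists Fy; split; first by move=> n; case: (hFy n).
  rewrite -(fineK mfin); apply/cvg_EFin; first exact: nearW.
  apply: (@squeeze_cvgr _ _ _ _ (cst (fine m)) (fun n => fine m + n.+1%:R^-1)).
  + near=> n; have [[oc _] /ltW ->] := hFy n; rewrite andbT.
    by rewrite -lee_fin fineK //; apply: ereal_inf_lbound; exists (Fy n).
  + exact: cvg_cst.
  + rewrite -[X in _ --> X]addr0; apply: cvgD; first exact: cvg_cst.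
    exact: cvg_harmonic.
Unshelve. all: by end_near.
Qed.
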